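(* Let $G$ be a finite abelian group of odd order and let $\mathcal{C}$ be a Haagerup-Izumi fusion category with $K_0(\mathcal{C})=HI(G)$, whose Drinfel'd center has the simple objects and twists described in the context. Suppose there is a metric group $(H,q'')$ of order $|G|^2+4=2m+1$ such that the simple objects $D_j$ of $\mathcal{Z}(\mathcal{C})$ are indexed by $h\in H\setminus\{e\}$, where $D_h=D_{h^{-1}}$, and $$\theta_{D_h}=e^{2\pi i\, m\, q''(h)} .$$ Then for every integer $k\ge1$ $$\nu_k(\rho)=\tfrac12\,\theta_k^G(e)+\tfrac12\,\Theta(H,kmq'').$$
   Context: **Haagerup-Izumi ring.** $HI(G)$ is the based ring with basis $G\cup\{g\rho: g\in G\}$, with the group law on $G$, $g(h\rho)=(gh)\rho=(h\rho)g^{-1}$, and $(g\rho)(h\rho)=gh^{-1}+\sum_{a\in G}a\rho$. A fusion category $\mathcal{C}$ over $\mathbb{C}$ is Haagerup-Izumi if its Grothendieck ring (basis: isomorphism classes of simple objects) is $K_0(\mathcal{C})=HI(G)$. **Notation.** $\theta_k^G(h)=|\{g\in G: g^k=h\}|$, and $e$ is the identity element. A quadratic form on a finite abelian group $A$ is a function $q:A\to\mathbb{Q}/\mathbb{Z}$ with $q(a^{-1})=q(a)$ such that $(a,b)\mapsto q(ab)-q(a)-q(b)$ is a symmetric bilinear form. $(A,q)$ is a metric group if this form is non-degenerate. For a quadratic form $q$ on $A$, $\Theta(A,q)=\frac{1}{\sqrt{|A|}}\sum_{a\in A}e^{2\pi i q(a)}$. $kmq''$ is the function $h\mapsto km\,q''(h)$,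 with $m=(|G|^2+3)/2$. **Indicators.** $\mathcal{C}$ is equipped with a spherical structure $j:\mathrm{Id}\to(\cdot)^{**}$, with categorical dimension $qdim$. $\nu_k(V)$, the $k$-th Frobenius-Schur indicator, is the trace of the endomorphism of $\mathrm{Hom}_{\mathcal{C}}(\mathbb{1},V^{\otimes k})$ sending $f$ to $(\mathrm{ev}_V\otimes \mathrm{id}_{V^{\otimes(k-1)}}\otimes j_V^{-1})(\mathrm{id}_{V^*}\otimes f\otimes\mathrm{id}_{V^{**}})\mathrm{db}_{V^*}$, with $\mathrm{ev}_V:V^*\otimes V\to\mathbb{1}$, $\mathrm{db}_V:\mathbb{1}\to V\otimes V^*$ the duality maps. **Center.** $\mathcal{Z}(\mathcal{C})$ is the Drinfel'd center, $F:\mathcal{Z}(\mathcal{C})\to\mathcal{C}$ the forgetful functor, and $\theta_X$ the scalar twist of a simple object $X$, oriented so that $\nu_k(Y)=\frac{1}{qdim(\mathcal{C})}\sum_X\theta_X^k\,qdim(X)\dim\mathrm{Hom}_{\mathcal{C}}(F(X),Y)$, $X$ running over the simple objects of $\mathcal{Z}(\mathcal{C})$. **Description of the center (Evans-Gannon).** The simple objects of $\mathcal{Z}(\mathcal{C})$ are: $\mathbb{1}$, with $F(\mathbb{1})=\mathbb{1}$, $\theta=1$; $B$, with $F(B)=\mathbb{1}+\sum_{g\in G}g\rho$, $\theta=1$; $A_\psi=A_{\bar\psi}$ for $\psi\in\widehat{G}$ nontrivial, with $F(A_\psi)=2\,\mathbb{1}+\sum_{g\in G}g\rho$, $\theta=1$;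 $C^{(h)}_\phi$ for $h\in G\setminus\{e\}$ taken up to $h\leftrightarrow h^{-1}$ (one representative $h$ chosen from each pair) and $\phi\in\widehat{G}$, with $F(C^{(h)}_\phi)=h+h^{-1}+\sum_{g\in G}g\rho$, $\theta=\phi(h)$; and $D_j$ for $1\le j\le\frac{|G|^2+3}{2}$, with $F(D_j)=\sum_{g\in G}g\rho$. Here $\widehat{G}$ is the group of linear characters of $G$.
   Formalization: The formal theorem also assumes that the categorical dimension qdim(ρ) is positive; without this the claim is false (Yang-Lee category, G trivial, k=1: left side 0, right side 1), and for negative qdim(ρ) the Gauss-sum term always has the opposite sign. *)

(* Defs.v *)
(* The field of complex numbers is R[i] for R : realType. *)
From HB Require Import structures.
From mathcomp Require Import all_boot all_order all_fingroup all_algebra.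
From mathcomp Require Import generic_quotient ring_quotient archimedean complex.
From mathcomp Require Import boolp reals trigo.

Set Implicit Arguments.
Unset Strict Implicit.
Unset Printing Implicit Defensive.

Import Order.TTheory GRing.Theory Num.Theory.
Local Open Scope ring_scope.

Declare Scope cat_scope.
Delimit Scope cat_scope with cat.

Reserved Notation "g \oc f" (at level 50, left associativity).
Reserved Notation "X \ot Y" (at level 40, left associativity).
Reserved Notation "f \om g" (at level 40, left associativity).

Record category := Category {
  cob :> Type;
  chom : cob -> cob -> Type;
  cidm : forall X, chom X X;
  ccomp : forall X Y Z, chom Y Z -> chom X Y -> chom X Z;
  ccompA : forall X Y Z W (h : chom Z W) (g : chom Y Z) (f : chom X Y),
    ccomp h (ccomp g f) = ccomp (ccomp h g) f;
  ccomp1m : forall X Y (f : chom X Y), ccomp (cidm Y) f = f;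
  ccompm1 : forall X Y (f : chom X Y), ccomp f (cidm X) = f }.

Section CategoryNotions.
Variable C : category.

Definition is_mono (X Y : C) (f : chom X Y) : Prop :=
  forall (Z : C) (g h : chom Z X), ccomp f g = ccomp f h -> g = h.

Definition is_epi (X Y : C) (f : chom X Y) : Prop :=
  forall (Z : C) (g h : chom Y Z), ccomp g f = ccomp h f -> g = h.

Definition is_iso (X Y : C) (f : chom X Y) : Prop :=
  exists g : chom Y X, ccomp g f = cidm X /\ ccomp f g = cidm Y.

Definition isomorphic (X Y : C) : Prop := exists f : chom X Y, is_iso f.

Definition is_zero_object (X : C) : Prop :=
  forall Y : C, (exists! f : chom X Y, True) /\ (exists! f : chom Y X, True).

Definition simple_object (X : C) : Prop :=
  ~ is_zero_object X /\
  forall (Y : C) (f : chom Y X), is_mono f -> is_zero_object Y \/ is_iso f.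

(* S lists each isomorphism class of simple objects exactly once. *)
Definition simple_reps (I : Type) (S : I -> C) : Prop :=
  [/\ forall i, simple_object (S i),
      forall i i', isomorphic (S i) (S i') -> i = i' &
      forall X, simple_object X -> exists i, isomorphic X (S i)].

End CategoryNotions.

(* Linear categories with finite-dimensional morphism spaces. *)
Record lincat (K : fieldType) := LinCat {
  lob :> Type;
  Mor : lob -> lob -> vectType K;
  idmor : forall X, Mor X X;
  mcomp : forall X Y Z, Mor Y Z -> Mor X Y -> Mor X Z;
  mcompA : forall X Y Z W (h : Mor Z W) (g : Mor Y Z) (f : Mor X Y),
    mcomp h (mcomp g f) = mcomp (mcomp h g) f;
  mcomp1m : forall X Y (f : Mor X Y), mcomp (idmor Y) f = f;
  mcompm1 : forall X Y (f : Mor X Y), mcomp f (idmor X) = f;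
  mcomp_linl : forall X Y Z (a : K) (g g' : Mor Y Z) (f : Mor X Y),
    mcomp (a *: g + g') f = a *: mcomp g f + mcomp g' f;
  mcomp_linr : forall X Y Z (a : K) (g : Mor Y Z) (f f' : Mor X Y),
    mcomp g (a *: f + f') = a *: mcomp g f + mcomp g f' }.

Notation "g \oc f" := (mcomp g f) : cat_scope.
Local Open Scope cat_scope.

Definition cat_of (K : fieldType) (C : lincat K) : category :=
  @Category (lob C) (fun X Y => Mor X Y : Type) (@idmor K C) (@mcomp K C)
    (@mcompA K C) (@mcomp1m K C) (@mcompm1 K C).

Section LinearNotions.
Variables (K : fieldType) (C : lincat K).
Implicit Types X Y Z : C.

Definition is_dsum (T : finType) (F : T -> C) X : Prop :=
  exists (inj : forall t, Mor (F t) X) (prj : forall t, Mor X (F t)),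
    [/\ forall t, prj t \oc inj t = idmor (F t),
        forall s t, s <> t -> prj t \oc inj s = 0 &
        \sum_t (inj t \oc prj t) = idmor X].

(* X is the direct sum of n b copies of S b, b in B; when S lists the simple
   objects this says that the class of X in K_0(C) is the sum of the n b [S b]. *)
Definition has_class (B : finType) (S : B -> C) X (n : B -> nat) : Prop :=
  is_dsum (fun t : {b : B & 'I_(n b)} => S (tag t)) X.

Definition is_kernel X Y (f : Mor X Y) Z (k : Mor Z X) : Prop :=
  f \oc k = 0 /\
  forall W (g : Mor W X), f \oc g = 0 -> exists! h : Mor W Z, k \oc h = g.

Definition is_cokernel X Y (f : Mor X Y) Z (c : Mor Y Z) : Prop :=
  c \oc f = 0 /\
  forall W (g : Mor Y W), g \oc f = 0 -> exists! h : Mor Z W, h \oc c = g.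

Definition abelian_category : Prop :=
  [/\ forall n (F : 'I_n -> C), exists X, is_dsum F X,
      forall X Y (f : Mor X Y), exists Z (k : Mor Z X), is_kernel f k,
      forall X Y (f : Mor X Y), exists Z (c : Mor Y Z), is_cokernel f c,
      forall X Y (f : Mor X Y), @is_mono (cat_of C) X Y f ->
        exists Z (g : Mor Y Z), is_kernel g f &
      forall X Y (f : Mor X Y), @is_epi (cat_of C) X Y f ->
        exists Z (g : Mor Z X), is_cokernel g f].

Definition semisimple_category : Prop :=
  forall X, exists n (F : 'I_n -> C),
    (forall i, @simple_object (cat_of C) (F i)) /\ is_dsum F X.

(* The scalar c such that f = c *: idmor X, for f proportional to idmor X <> 0. *)
Definition scalar_of X (f : Mor X X) : K := coord [tuple idmor X] ord0 f.

End LinearNotions.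

Record moncat (K : fieldType) := MonCat {
  mbase :> lincat K;
  munit : mbase;
  tens : mbase -> mbase -> mbase;
  tensm : forall X X' Y Y' : mbase,
    Mor X X' -> Mor Y Y' -> Mor (tens X Y) (tens X' Y');
  tensm_linl : forall (X X' Y Y' : mbase) a (f f' : Mor X X') (g : Mor Y Y'),
    tensm (a *: f + f') g = a *: tensm f g + tensm f' g;
  tensm_linr : forall (X X' Y Y' : mbase) a (f : Mor X X') (g g' : Mor Y Y'),
    tensm f (a *: g + g') = a *: tensm f g + tensm f g';
  tensm_id : forall X Y : mbase, tensm (idmor X) (idmor Y) = idmor (tens X Y);
  tensm_comp : forall (X X' X'' Y Y' Y'' : mbase)
    (f' : Mor X' X'') (f : Mor X X') (g' : Mor Y' Y'') (g : Mor Y Y'),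
    tensm (f' \oc f) (g' \oc g) = tensm f' g' \oc tensm f g;
  asc : forall X Y Z : mbase, Mor (tens (tens X Y) Z) (tens X (tens Y Z));
  ascV : forall X Y Z : mbase, Mor (tens X (tens Y Z)) (tens (tens X Y) Z);
  ascK : forall X Y Z : mbase, ascV X Y Z \oc asc X Y Z = idmor _;
  ascVK : forall X Y Z : mbase, asc X Y Z \oc ascV X Y Z = idmor _;
  asc_nat : forall (X X' Y Y' Z Z' : mbase)
    (f : Mor X X') (g : Mor Y Y') (h : Mor Z Z'),
    asc X' Y' Z' \oc tensm (tensm f g) h = tensm f (tensm g h) \oc asc X Y Z;
  lun : forall X : mbase, Mor (tens munit X) X;
  lunV : forall X : mbase, Mor X (tens munit X);
  lunK : forall X : mbase, lunV X \oc lun X = idmor _;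
  lunVK : forall X : mbase, lun X \oc lunV X = idmor _;
  lun_nat : forall (X X' : mbase) (f : Mor X X'),
    lun X' \oc tensm (idmor munit) f = f \oc lun X;
  run : forall X : mbase, Mor (tens X munit) X;
  runV : forall X : mbase, Mor X (tens X munit);
  runK : forall X : mbase, runV X \oc run X = idmor _;
  runVK : forall X : mbase, run X \oc runV X = idmor _;
  run_nat : forall (X X' : mbase) (f : Mor X X'),
    run X' \oc tensm f (idmor munit) = f \oc run X;
  pentagon : forall X Y Z W : mbase,
    asc X Y (tens Z W) \oc asc (tens X Y) Z W =
    tensm (idmor X) (asc Y Z W) \oc asc X (tens Y Z) W
      \oc tensm (asc X Y Z) (idmor W);
  triangle : forall X Y : mbase,
    tensm (idmor X) (lun Y) \oc asc X munit Y = tensm (run X) (idmor Y) }.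

Arguments munit {K m}.
Notation "X \ot Y" := (tens X Y) : cat_scope.
Notation "f \om g" := (tensm f g) : cat_scope.

(* V' is a left dual of V: e : V' V -> 1 and d : 1 -> V V' satisfy the zigzags. *)
Definition is_left_dual (K : fieldType) (C : moncat K) (V' V : C)
    (e : Mor (V' \ot V) munit) (d : Mor munit (V \ot V')) : Prop :=
  run V \oc (idmor V \om e) \oc asc V V' V \oc (d \om idmor V) \oc lunV V = idmor V /\
  lun V' \oc (e \om idmor V') \oc ascV V' V V' \oc (idmor V' \om d) \oc runV V'
    = idmor V'.

Record rigidcat (K : fieldType) := RigidCat {
  rbase :> moncat K;
  ldual : rbase -> rbase;
  evd : forall V : rbase, Mor (ldual V \ot V) munit;
  dbd : forall V : rbase, Mor munit (V \ot ldual V);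
  dualP : forall V : rbase, is_left_dual (evd V) (dbd V);
  right_dualP : forall V : rbase, exists (V' : rbase)
    (e : Mor (V \ot V') munit) (d : Mor munit (V' \ot V)), is_left_dual e d }.

Record fusioncat (K : fieldType) := FusionCat {
  fbase :> rigidcat K;
  fusion_abelian : abelian_category fbase;
  fusion_semisimple : semisimple_category fbase;
  fusion_finite : exists (I : finType) (S : I -> fbase),
    @simple_reps (cat_of fbase) I S;
  fusion_unit : @simple_object (cat_of fbase) munit }.

Section Duality.
Variables (K : fieldType) (C : rigidcat K).
Implicit Types V W A : C.

(* The morphism A -> V^* corresponding to a pairing A V -> 1. *)
Definition mtranspose A V (e : Mor (A \ot V) munit) : Mor A (ldual V) :=
  lun _ \oc (e \om idmor (ldual V)) \oc ascV A V (ldual V)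
    \oc (idmor A \om dbd V) \oc runV A.

Definition dualm V W (f : Mor V W) : Mor (ldual W) (ldual V) :=
  mtranspose (evd W \oc (idmor (ldual W) \om f)).

Definition dual_tens V W : Mor (ldual W \ot ldual V) (ldual (V \ot W)) :=
  mtranspose (evd W
    \oc (idmor (ldual W) \om (lun W \oc (evd V \om idmor W) \oc ascV (ldual V) V W))
    \oc asc (ldual W) (ldual V) (V \ot W)).

Definition dual_unit : Mor munit (ldual (munit : C)) := mtranspose (lun munit).

(* A pivotal structure is a monoidal natural isomorphism V -> V^**; the two
   monoidality conditions compare j with the canonical isomorphisms
   V^** W^** = (V W)^** and 1 = 1^**, after composition with (dual_tens V W)^*
   and dual_unit^* respectively, which avoids inverses. *)
Record pivotal := Pivotal {
  piv : forall V, Mor V (ldual (ldual V));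
  pivV : forall V, Mor (ldual (ldual V)) V;
  pivK : forall V, pivV V \oc piv V = idmor V;
  pivVK : forall V, piv V \oc pivV V = idmor _;
  piv_nat : forall V W (f : Mor V W),
    piv W \oc f = dualm (dualm f) \oc piv V;
  piv_tens : forall V W,
    dualm (dual_tens V W) \oc piv (V \ot W)
    = dual_tens (ldual W) (ldual V) \oc (piv V \om piv W);
  piv_unit : dualm dual_unit \oc piv munit = dual_unit }.

Definition qdim (j : pivotal) V : K :=
  scalar_of (evd (ldual V) \oc (piv j V \om idmor (ldual V)) \oc dbd V).

Record spherical := Spherical {
  spiv :> pivotal;
  sphericalP : forall V, qdim spiv V = qdim spiv (ldual V) }.

End Duality.

(* For C with simple objects listed by S. *)
Definition global_dim (K : fieldType) (C : rigidcat K) (j : spherical C)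
    (I : finType) (S : I -> C) : K :=
  \sum_i qdim j (S i) ^+ 2.

Section Indicators.
Variable K : fieldType.

Definition vtrace (E : vectType K) (f : E -> E) : K :=
  \sum_(i < \dim {:E}) coord (vbasis {:E}) i (f (vbasis {:E})`_i).

Fixpoint tpow (C : moncat K) (V : C) (k : nat) : C :=
  if k is k'.+1 then V \ot tpow V k' else munit.

(* The coherence isomorphism V^k V -> V V^k. *)
Fixpoint tpow_shift (C : moncat K) (V : C) (k : nat) :
    Mor (tpow V k \ot V) (tpow V k.+1) :=
  match k with
  | 0 => runV V \oc lun V
  | k'.+1 => (idmor V \om tpow_shift V k') \oc asc V (tpow V k') V
  end.

Variables (C : rigidcat K) (j : pivotal C).

(* The rotation of Mor(1, V^(k+1)). *)
Definition rotation (V : C) (k : nat) (f : Mor munit (tpow V k.+1)) :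
    Mor munit (tpow V k.+1) :=
  let W := tpow V k in
  let V' := ldual V in
  let V'' := ldual V' in
  tpow_shift V k
    \oc (lun (W \ot V) \oc (evd V \om (idmor W \om pivV j V)))
    \oc (ascV V' V (W \ot V'') \oc (idmor V' \om asc V W V''))
    \oc (idmor V' \om (f \om idmor V'')) \oc (idmor V' \om lunV V'')
    \oc dbd V'.

(* Meaningful for k >= 1. *)
Definition FS_indicator (k : nat) (V : C) : K := vtrace (@rotation V k.-1).

End Indicators.

Section Center.
Variables (K : fieldType) (C : rigidcat K).

Record center_ob := CenterOb {
  forget :> C;
  hbr : forall W : C, Mor (forget \ot W) (W \ot forget);
  hbr_iso : forall W : C, @is_iso (cat_of C) _ _ (hbr W);
  hbr_nat : forall (W W' : C) (f : Mor W W'),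
    hbr W' \oc (idmor forget \om f) = (f \om idmor forget) \oc hbr W;
  hbr_tens : forall W W' : C,
    asc W W' forget \oc hbr (W \ot W') \oc asc forget W W'
    = (idmor W \om hbr W') \oc asc W forget W' \oc (hbr W \om idmor W') }.

Definition center_mor (X Y : center_ob) (f : Mor X Y) : Prop :=
  forall W : C, (idmor W \om f) \oc hbr X W = hbr Y W \oc (f \om idmor W).

Definition center_hom (X Y : center_ob) : Type := {f : Mor X Y | center_mor f}.

Lemma center_mor_id (X : center_ob) : center_mor (idmor (forget X)).
Proof. by move=> W; rewrite !tensm_id mcomp1m mcompm1. Qed.

Lemma center_mor_comp (X Y Z : center_ob) (g : Mor Y Z) (f : Mor X Y) :
  center_mor g -> center_mor f -> center_mor (g \oc f).
Proof.
move=> gP fP W; have e : idmor W = idmor W \oc idmor W by rewrite mcomp1m.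
by rewrite {1}e tensm_comp -mcompA fP mcompA gP -mcompA -tensm_comp -e.
Qed.

Definition center_id X : center_hom X X := exist _ _ (center_mor_id X).

Definition center_comp X Y Z (g : center_hom Y Z) (f : center_hom X Y) :
    center_hom X Z :=
  exist _ (sval g \oc sval f) (center_mor_comp (svalP g) (svalP f)).

Fact center_hom_inj X Y (f g : center_hom X Y) : sval f = sval g -> f = g.
Proof.
by case: f g => [f fP] [g gP] /= e; rewrite e in fP *; rewrite (Prop_irrelevance fP gP).
Qed.

Fact center_compA X Y Z W
    (h : center_hom Z W) (g : center_hom Y Z) (f : center_hom X Y) :
  center_comp h (center_comp g f) = center_comp (center_comp h g) f.
Proof. by apply: center_hom_inj; rewrite /= mcompA. Qed.

Fact center_comp1m X Y (f : center_hom X Y) : center_comp (center_id Y) f = f.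
Proof. by apply: center_hom_inj; rewrite /= mcomp1m. Qed.

Fact center_compm1 X Y (f : center_hom X Y) : center_comp f (center_id X) = f.
Proof. by apply: center_hom_inj; rewrite /= mcompm1. Qed.

Definition drinfeld_center : category :=
  Category center_compA center_comp1m center_compm1.

(* The Drinfeld isomorphism X -> X^**. *)
Definition drinfeld_iso (X : center_ob) : Mor X (ldual (ldual X)) :=
  lun _ \oc (evd X \om idmor _) \oc (hbr X (ldual X) \om idmor _)
    \oc ascV X (ldual X) (ldual (ldual X)) \oc (idmor X \om dbd (ldual X)) \oc runV X.

(* c is the scalar by which the twist (o = true), resp. the inverse of the
   twist (o = false), of Z(C) acts on the simple object X; the twist is the
   inverse of drinfeld_iso composed with j. *)
Definition is_twist (j : pivotal C) (o : bool) (X : drinfeld_center) (c : K) : Prop :=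
  if o then piv j (forget X) = c *: drinfeld_iso X
  else drinfeld_iso X = c *: piv j (forget X).

End Center.

Section HaagerupIzumi.
Variable gT : finGroupType.

(* inl g stands for g and inr g for g rho. *)
Definition HIbasis : finType := (gT + gT)%type.

(* The coefficient of c in the product a b in HI(G); the third case is
   (h rho) g = (g^-1 h) rho. *)
Definition HImul (a b c : HIbasis) : nat :=
  match a, b with
  | inl g, inl h => (c == inl (g * h)%g)
  | inl g, inr h => (c == inr (g * h)%g)
  | inr h, inl g => (c == inr (g^-1 * h)%g)
  | inr g, inr h =>
      ((c == inl (g * h^-1)%g) + \sum_(a : gT) (c == inr a))%N
  end.

(* S identifies K_0(C) with HI(G): it lists the simple objects, and their
   tensor products have the structure constants of HI(G). *)
Definition is_HI (K : fieldType) (C : fusioncat K) (S : HIbasis -> C) : Prop :=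
  [/\ @simple_reps (cat_of C) HIbasis S,
      @isomorphic (cat_of C) (S (inl 1%g)) munit &
      forall a b, has_class S (S a \ot S b) (HImul a b)].

(* The element sum_g f(g) g + sum_g g rho of HI(G). *)
Definition plus_Grho (f : gT -> nat) (b : HIbasis) : nat :=
  match b with inl g => f g | inr _ => 1 end.

Definition HIm : nat := ((#|gT| ^ 2 + 3)./2)%N.

Definition lin_char (F : pzRingType) (phi : {ffun gT -> F}) : Prop :=
  phi 1%g = 1 /\ forall g h, phi (g * h)%g = phi g * phi h.

Definition pow_count (k : nat) (h : gT) : nat := #|[set g : gT | (g ^+ k)%g == h]|.

End HaagerupIzumi.

(* Evans and Gannon's list of the simple objects of Z(C), with
   representatives X : I -> Z(C), whose twists are theta.  The
   index maps zA and zC are only meaningful on linear characters (nontrivial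
   ones for zA), zC only on the set zreps of chosen representatives h. *)
Record EG_center (F : numClosedFieldType) (gT : finGroupType)
    (C : fusioncat F) (S : HIbasis gT -> C)
    (I : finType) (X : I -> drinfeld_center C) (theta : I -> F) := EGCenter {
  z1 : I;
  zB : I;
  zA : {ffun gT -> F} -> I;
  zreps : {set gT};
  zC : gT -> {ffun gT -> F} -> I;
  zD : 'I_(HIm gT) -> I;
  zrepsP : forall h, (h \in zreps) = (h != 1%g) && (h^-1%g \notin zreps);
  z_exhaust : forall i,
    i = z1 \/ i = zB \/
    (exists psi, [/\ lin_char psi, psi <> [ffun=> 1] & i = zA psi]) \/
    (exists h phi, [/\ h \in zreps, lin_char phi & i = zC h phi]) \/
    (exists l, i = zD l);
  z_1B : z1 <> zB;
  z_1A : forall psi, lin_char psi -> psi <> [ffun=> 1] -> z1 <> zA psi;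
  z_1C : forall h phi, h \in zreps -> lin_char phi -> z1 <> zC h phi;
  z_1D : forall l, z1 <> zD l;
  z_BA : forall psi, lin_char psi -> psi <> [ffun=> 1] -> zB <> zA psi;
  z_BC : forall h phi, h \in zreps -> lin_char phi -> zB <> zC h phi;
  z_BD : forall l, zB <> zD l;
  z_AC : forall psi h phi, lin_char psi -> psi <> [ffun=> 1] ->
    h \in zreps -> lin_char phi -> zA psi <> zC h phi;
  z_AD : forall psi l, lin_char psi -> psi <> [ffun=> 1] -> zA psi <> zD l;
  z_CD : forall h phi l, h \in zreps -> lin_char phi -> zC h phi <> zD l;
  z_A_eq : forall psi psi', lin_char psi -> psi <> [ffun=> 1] ->
    lin_char psi' -> psi' <> [ffun=> 1] ->
    zA psi = zA psi' <-> psi = psi' \/ psi' = [ffun g => (psi g)^*];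
  z_C_inj : forall h h' phi phi', h \in zreps -> lin_char phi ->
    h' \in zreps -> lin_char phi' ->
    zC h phi = zC h' phi' -> h = h' /\ phi = phi';
  z_D_inj : injective zD;
  forget_1 : @isomorphic (cat_of C) (forget (X z1)) munit;
  forget_B : has_class S (forget (X zB)) (plus_Grho (fun g => (g == 1%g) : nat));
  forget_A : forall psi, lin_char psi -> psi <> [ffun=> 1] ->
    has_class S (forget (X (zA psi))) (plus_Grho (fun g => 2 * (g == 1%g))%N);
  forget_C : forall h phi, h \in zreps -> lin_char phi ->
    has_class S (forget (X (zC h phi)))
      (plus_Grho (fun g => (g == h) + (g == h^-1%g))%N);
  forget_D : forall l, has_class S (forget (X (zD l))) (plus_Grho (fun=> 0%N));
  theta_1 : theta z1 = 1;
  theta_B : theta zB = 1;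
  theta_A : forall psi, lin_char psi -> psi <> [ffun=> 1] -> theta (zA psi) = 1;
  theta_C : forall h phi, h \in zreps -> lin_char phi ->
    theta (zC h phi) = phi h }.

Definition QmodZ : zmodType :=
  {ideal_quot ((@Num.int_num_subdef rat : {pred rat}) : zmodClosed rat)}.

Section QuadraticForms.
Variable hT : finGroupType.

Definition polar (q : hT -> QmodZ) (a b : hT) : QmodZ := q (a * b)%g - q a - q b.

Definition quadratic_form (q : hT -> QmodZ) : Prop :=
  [/\ forall a, q a^-1%g = q a,
      forall a b, polar q a b = polar q b a,
      forall a a' b, polar q (a * a')%g b = polar q a b + polar q a' b &
      forall a b b', polar q a (b * b')%g = polar q a b + polar q a b'].

Definition metric_group (q : hT -> QmodZ) : Prop :=
  [/\ abelian [set: hT], quadratic_form q &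
      forall a, (forall b, polar q a b = 0) -> a = 1%g].

End QuadraticForms.

(* e^(2 pi i x), computed on the canonical representative of x in rat. *)
Definition expQZ (R : realType) (x : QmodZ) : R[i] :=
  let t := 2 * pi * ratr (repr x : rat) in Complex (cos t) (sin t).

Definition gauss_sum (R : realType) (hT : finGroupType) (q : hT -> QmodZ) : R[i] :=
  (sqrtC #|hT|%:R)^-1 * \sum_(a : hT) expQZ R (q a).

(* Main.v *)
Require Import Defs.
From HB Require Import structures.
From mathcomp Require Import all_boot all_order all_fingroup all_algebra.
From mathcomp Require Import generic_quotient ring_quotient archimedean complex.
From mathcomp Require Import boolp reals trigo.
From mathcomp Require Import cyclic pgroup mxrepresentation spectral.
From mathcomp Require Import ring.


(** Why the formula holds. Put [n = #|G|] and [d = qdim rho > 0]. The indicator of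
    rho is the sum over the simple objects X of the center of [theta_X ^ k], weighted
    by [qdim (F X) * dim Hom (F X, rho)] and divided by the global dimension, and
    everything in it can be made explicit.

    The dimension is additive and multiplicative ([qdim_dsum], [qdim_tens]), hence a
    character of the ring HI(G). As the order of G is odd this forces [qdim g = 1]
    and [qdim (g rho) = d] ([qdim_inl], [qdim_inr]), and then [d^2 = 1 + n d] and
    [global_dim = n (2 + n d)]; positivity of [d] gives [sqrt (n^2 + 4) = 2 d - n]
    ([sqrt_discriminant]). By Schur's lemma, [dim Hom (F X, rho)] is 0 for the unit
    and 1 for every other simple X ([dim_hom_class]), so the weights are [1 + n d]
    for B, [2 + n d] for the A's and C's, and [n d] for the D's.

    There are [(n - 1) / 2] objects A. The sum over the objects C is evaluated by
    orthogonality of the characters of G ([lin_char_basis]) and leaves a count of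
    solutions of [h^k = 1] ([center_sum_rho]). The map [h |-> D_h] is two-to-one on
    the non-identity elements, and the element 1 contributes 1 to the Gauss sum, so
    the twists of the D's sum to [(G_k - 1) / 2], where [G_k] is the unnormalized
    Gauss sum. Altogether the weighted sum is
    [n (2 + n d) / 2 * pow_count k 1 + n d / 2 * G_k], and division by [n (2 + n d)]
    finishes, because [d * sqrt (n^2 + 4) = 2 d^2 - n d = 2 + n d].

    Multiplicativity of the dimension takes the most work, since associators and
    unitors are not identities. Pairings and copairings are therefore replaced by
    the transformations [pact] and [cact] that they induce between iterated left
    tensor products, for which the associators drop out; the usual picture of nested
    loops then applies verbatim ([ptr_tens]). *)

Set Implicit Arguments.
Unset Strict Implicit.
Unset Printing Implicit Defensive.

Import Order.TTheory GRing.Theory Num.Theory.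
Local Open Scope ring_scope.

(** * Linear and monoidal categories *)

Section Linear.
Local Open Scope cat_scope.
Variables (K : fieldType) (C : lincat K).
Implicit Types X Y Z : C.

Definition precomp X Y Z (f : Mor X Y) (g : Mor Y Z) := g \oc f.
Definition postcomp X Y Z (g : Mor Y Z) (f : Mor X Y) := g \oc f.

Fact precomp_linear X Y Z (f : Mor X Y) : linear (@precomp X Y Z f).
Proof. by move=> a g g'; rewrite /precomp mcomp_linl. Qed.

Fact postcomp_linear X Y Z (g : Mor Y Z) : linear (@postcomp X Y Z g).
Proof. by move=> a f f'; rewrite /postcomp mcomp_linr. Qed.

HB.instance Definition _ X Y Z (f : Mor X Y) :=
  GRing.isLinear.Build K (Mor Y Z) (Mor X Z) _ (@precomp X Y Z f) (precomp_linear f).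
HB.instance Definition _ X Y Z (g : Mor Y Z) :=
  GRing.isLinear.Build K (Mor X Y) (Mor X Z) _ (@postcomp X Y Z g) (postcomp_linear g).

Lemma mcomp0l X Y Z (f : Mor X Y) : (0 : Mor Y Z) \oc f = 0.
Proof. exact: (linear0 (@precomp _ _ Z f)). Qed.
Lemma mcomp0r X Y Z (g : Mor Y Z) : g \oc (0 : Mor X Y) = 0.
Proof. exact: (linear0 (@postcomp X _ _ g)). Qed.
Lemma mcompBl X Y Z (f : Mor X Y) (g h : Mor Y Z) : (g - h) \oc f = (g \oc f) - (h \oc f).
Proof. exact: (linearB (@precomp _ _ Z f)). Qed.
Lemma mcompBr X Y Z (f h : Mor X Y) (g : Mor Y Z) : g \oc (f - h) = (g \oc f) - (g \oc h).
Proof. exact: (linearB (@postcomp X _ _ g)). Qed.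
Lemma mcompZl X Y Z (f : Mor X Y) (g : Mor Y Z) a : (a *: g) \oc f = a *: (g \oc f).
Proof. by have := mcomp_linl a g 0 f; rewrite mcomp0l !addr0. Qed.
Lemma mcompZr X Y Z (f : Mor X Y) (g : Mor Y Z) a : g \oc (a *: f) = a *: (g \oc f).
Proof. by have := mcomp_linr a g f 0; rewrite mcomp0r !addr0. Qed.
Lemma mcomp_suml X Y Z (T : finType) (f : Mor X Y) (g : T -> Mor Y Z) :
  (\sum_t g t) \oc f = \sum_t (g t \oc f).
Proof. exact: (linear_sum (@precomp _ _ Z f)). Qed.
Lemma mcomp_sumr X Y Z (T : finType) (f : T -> Mor X Y) (g : Mor Y Z) :
  g \oc (\sum_t f t) = \sum_t (g \oc f t).
Proof. exact: (linear_sum (@postcomp X _ _ g)). Qed.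

End Linear.

Section Monoidal.
Local Open Scope cat_scope.
Variables (K : fieldType) (C : moncat K).
Implicit Types X Y Z W A V : C.

(** Words of morphisms are kept nested to the left, so an equation between two
    words is rewritten inside a longer one in the form given here. *)
Lemma compr X Y Z W (f : Mor X Y) (g : Mor Y Z) h :
  g \oc f = h -> forall k : Mor Z W, k \oc g \oc f = k \oc h.
Proof. by move=> e k; rewrite -mcompA e. Qed.

Lemma whiskl A X Y Z (g : Mor Y Z) (f : Mor X Y) :
  (idmor A \om g) \oc (idmor A \om f) = idmor A \om (g \oc f).
Proof. by rewrite -tensm_comp mcomp1m. Qed.

Lemma whiskr A X Y Z (g : Mor Y Z) (f : Mor X Y) :
  (g \om idmor A) \oc (f \om idmor A) = (g \oc f) \om idmor A.
Proof. by rewrite -tensm_comp mcomp1m. Qed.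

Lemma whisk_xchg X X' Y Y' (f : Mor X X') (g : Mor Y Y') :
  (idmor X' \om g) \oc (f \om idmor Y) = (f \om idmor Y') \oc (idmor X \om g).
Proof. by rewrite -!tensm_comp !mcomp1m !mcompm1. Qed.

Lemma mcomp_can X Y Z (f : Mor X Y) (f' : Mor Y X) (g h : Mor Y Z) :
  f \oc f' = idmor Y -> g \oc f = h \oc f -> g = h.
Proof.
by move=> ff' e; rewrite -(mcompm1 g) -(mcompm1 h) -ff' !mcompA e.
Qed.

Lemma mcomp_canl X Y Z (f : Mor X Y) (f' : Mor Y X) (g h : Mor Z X) :
  f' \oc f = idmor X -> f \oc g = f \oc h -> g = h.
Proof.
by move=> ff' e; rewrite -(mcomp1m g) -(mcomp1m h) -ff' -!mcompA e.
Qed.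

Lemma ascV_nat (X X' Y Y' Z Z' : C) (f : Mor X X') (g : Mor Y Y') (h : Mor Z Z') :
  ascV X' Y' Z' \oc (f \om (g \om h)) = ((f \om g) \om h) \oc ascV X Y Z.
Proof.
apply: (mcomp_canl (ascK _ _ _)).
by rewrite !mcompA ascVK mcomp1m asc_nat (compr (ascVK _ _ _)) mcompm1.
Qed.

Lemma lunV_nat X X' (f : Mor X X') :
  (idmor munit \om f) \oc lunV X = lunV X' \oc f.
Proof.
apply: (mcomp_canl (lunK _)).
by rewrite !mcompA lunVK mcomp1m lun_nat (compr (lunVK _)) mcompm1.
Qed.

Lemma whiskr_inj X X' (f g : Mor X X') :
  f \om idmor munit = g \om idmor munit -> f = g.
Proof. by move=> e; apply: (mcomp_can (runVK X)); rewrite -!run_nat e. Qed.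

Lemma whiskl_inj X X' (f g : Mor X X') :
  idmor munit \om f = idmor munit \om g -> f = g.
Proof. by move=> e; apply: (mcomp_can (lunVK X)); rewrite -!lun_nat e. Qed.

(** Kelly's argument: tensoring with the unit on the left is faithful, and after
    that the two sides are compared by one pentagon and two triangles. *)
Lemma lun_tens X Y : lun (X \ot Y) \oc asc munit X Y = lun X \om idmor Y.
Proof.
apply: whiskl_inj; rewrite -whiskl.
have fK : asc munit (munit \ot X) Y \oc (asc munit munit X \om idmor Y)
  \oc ((ascV munit munit X \om idmor Y) \oc ascV munit (munit \ot X) Y) = idmor _.
  by rewrite !mcompA (compr (whiskr _ _ _)) ascVK tensm_id mcompm1 ascVK.
apply: (mcomp_can fK).
rewrite [RHS]mcompA -asc_nat -[RHS]mcompA whiskr triangle.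
rewrite -!mcompA [X in _ \oc X]mcompA -pentagon mcompA triangle.
by rewrite -tensm_id -asc_nat.
Qed.

Lemma pentagon_mix A V W Y :
  ascV A V (W \ot Y) \oc (idmor A \om asc V W Y) \oc asc A (V \ot W) Y
  = asc (A \ot V) W Y \oc (ascV A V W \om idmor Y).
Proof.
apply: (mcomp_canl (ascK _ _ _)); rewrite !mcompA ascVK mcomp1m pentagon.
by rewrite (compr (whiskr _ _ _)) ascVK tensm_id mcompm1.
Qed.

Lemma pentagon_invr X A W Y :
  ascV X (A \ot W) Y \oc (idmor X \om ascV A W Y) \oc asc X A (W \ot Y)
    \oc asc (X \ot A) W Y = asc X A W \om idmor Y.
Proof.
rewrite (compr (pentagon _ _ _ _)) !mcompA (compr (whiskl _ _ _)) ascK tensm_id.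
by rewrite mcompm1 ascK mcomp1m.
Qed.

Lemma pentagonV X A W Y :
  asc (X \ot A) W Y \oc (ascV X A W \om idmor Y) \oc ascV X (A \ot W) Y
    \oc (idmor X \om ascV A W Y) = ascV X A (W \ot Y).
Proof.
rewrite -pentagon_mix (compr (ascVK _ _ _)) mcompm1 (compr (whiskl _ _ _)).
by rewrite ascVK tensm_id mcompm1.
Qed.

Lemma lunV_tens X Y : asc munit X Y \oc (lunV X \om idmor Y) = lunV (X \ot Y).
Proof.
apply: (mcomp_canl (lunK _)).
by rewrite mcompA lun_tens whiskr !lunVK tensm_id.
Qed.

Lemma triangleV A Y :
  asc A munit Y \oc (runV A \om idmor Y) = idmor A \om lunV Y.
Proof.
have lK : (idmor A \om lunV Y) \oc (idmor A \om lun Y) = idmor _.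
  by rewrite whiskl lunK tensm_id.
apply: (mcomp_canl lK).
by rewrite mcompA triangle whiskr whiskl runVK lunVK !tensm_id.
Qed.

(** A pairing [e] of [A] with [V] is made to act on [A (V Y)], and a copairing
    [d] to create [X (A Y)] out of [Y]. These transformations compose without
    associators, which makes the calculus of duals that of adjunctions between
    the endofunctors [V - ] of C. Both are locked so that rewriting by
    associativity of composition does not look inside. *)
Definition pact A V (e : Mor (A \ot V) munit) Y : Mor (A \ot (V \ot Y)) Y :=
  locked (lun Y \oc (e \om idmor Y) \oc ascV A V Y).

Definition cact X A (d : Mor munit (X \ot A)) Y : Mor Y (X \ot (A \ot Y)) :=
  locked (asc X A Y \oc (d \om idmor Y) \oc lunV Y).

Lemma pactE A V (e : Mor (A \ot V) munit) Y :
  pact e Y = lun Y \oc (e \om idmor Y) \oc ascV A V Y.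
Proof. by rewrite /pact -lock. Qed.

Lemma cactE X A (d : Mor munit (X \ot A)) Y :
  cact d Y = asc X A Y \oc (d \om idmor Y) \oc lunV Y.
Proof. by rewrite /cact -lock. Qed.

Lemma pact_nat A V (e : Mor (A \ot V) munit) Y Y' (f : Mor Y Y') :
  pact e Y' \oc (idmor A \om (idmor V \om f)) = f \oc pact e Y.
Proof.
rewrite !pactE (compr (ascV_nat _ _ _)) !mcompA tensm_id.
by rewrite -mcompA -mcompA [X in _ \oc X]mcompA -whisk_xchg !mcompA lun_nat.
Qed.

Lemma cact_nat X A (d : Mor munit (X \ot A)) Y Y' (f : Mor Y Y') :
  (idmor X \om (idmor A \om f)) \oc cact d Y = cact d Y' \oc f.
Proof.
rewrite !cactE !mcompA -asc_nat tensm_id (compr (whisk_xchg _ _)).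
by rewrite -!mcompA -lunV_nat.
Qed.

Lemma pact_inj A V (e e' : Mor (A \ot V) munit) :
  (forall Y, pact e Y = pact e' Y) -> e = e'.
Proof.
move=> /(_ munit); rewrite !pactE => /(mcomp_can (ascK _ _ _)) /(mcomp_canl (lunK _)).
exact: whiskr_inj.
Qed.

Lemma cact_inj X A (d d' : Mor munit (X \ot A)) :
  (forall Y, cact d Y = cact d' Y) -> d = d'.
Proof.
move=> /(_ munit); rewrite !cactE => /(mcomp_can (lunK _)) /(mcomp_canl (ascK _ _ _)).
exact: whiskr_inj.
Qed.

Lemma pact_comp A A' V V' (e : Mor (A' \ot V') munit)
    (u : Mor A A') (v : Mor V V') Y :
  pact (e \oc (u \om v)) Y = pact e Y \oc (u \om (v \om idmor Y)).
Proof. by rewrite !pactE (compr (ascV_nat _ _ _)) !mcompA (compr (whiskr _ _ _)). Qed.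

Lemma cact_comp X X' A A' (d : Mor munit (X \ot A))
    (u : Mor X X') (v : Mor A A') Y :
  cact ((u \om v) \oc d) Y = (u \om (v \om idmor Y)) \oc cact d Y.
Proof. by rewrite !cactE !mcompA -asc_nat (compr (whiskr _ _ _)). Qed.

(** Compatibility with right tensoring: with it, [(f \om idmor Y)] can be computed
    for every [f] built from pairings and copairings. *)
Lemma pact_tens A V (e : Mor (A \ot V) munit) W Y :
  pact e W \om idmor Y
  = pact e (W \ot Y) \oc (idmor A \om asc V W Y) \oc asc A (V \ot W) Y.
Proof.
rewrite !pactE -!whiskr -!mcompA [in RHS](mcompA (ascV _ _ _)) pentagon_mix !mcompA.
rewrite -(lun_tens W Y); congr (_ \oc _).
by rewrite -[in RHS]tensm_id (compr (asc_nat _ _ _)) mcompA.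
Qed.

Lemma cact_tens X A (d : Mor munit (X \ot A)) W Y :
  cact d W \om idmor Y
  = ascV X (A \ot W) Y \oc (idmor X \om ascV A W Y) \oc cact d (W \ot Y).
Proof.
rewrite !cactE -lunV_tens -!whiskr -[idmor (W \ot Y)]tensm_id !mcompA.
by rewrite (compr (esym (asc_nat _ _ _))) !mcompA pentagon_invr.
Qed.

Lemma loop_act X A (e : Mor (X \ot A) munit) (d : Mor munit (X \ot A)) Y :
  pact e Y \oc cact d Y = lun Y \oc ((e \oc d) \om idmor Y) \oc lunV Y.
Proof.
by rewrite !pactE !cactE !mcompA (compr (ascK _ _ _)) mcompm1 (compr (whiskr _ _ _)).
Qed.

(** The composite V -> X A V -> X that bends a string; a duality is a pair whose
    snakes are identities. *)
Definition snake X A V (d : Mor munit (X \ot A)) (e : Mor (A \ot V) munit) :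
    Mor V X :=
  run X \oc (idmor X \om e) \oc asc X A V \oc (d \om idmor V) \oc lunV V.

Lemma snake_act X A V (d : Mor munit (X \ot A)) (e : Mor (A \ot V) munit) Y :
  snake d e \om idmor Y = (idmor X \om pact e Y) \oc cact d (V \ot Y).
Proof.
have -> : snake d e = run X \oc (idmor X \om e) \oc cact d V.
  by rewrite /snake cactE !mcompA.
rewrite -2!whiskr cact_tens !mcompA; congr (_ \oc _).
rewrite pactE -triangle (compr (esym (ascV_nat _ _ _))) !mcompA (compr (ascVK _ _ _)) mcompm1.
by rewrite !whiskl.
Qed.

Lemma tensmDl X X' Y Y' (f f' : Mor X X') (g : Mor Y Y') :
  (f + f') \om g = (f \om g) + (f' \om g).
Proof. by have := tensm_linl 1 f f' g; rewrite !scale1r. Qed.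

Lemma tensm0l X X' Y Y' (g : Mor Y Y') : (0 : Mor X X') \om g = 0.
Proof. by apply: (addrI ((0 : Mor X X') \om g)); rewrite -tensmDl !addr0. Qed.

Lemma tensmZl X X' Y Y' a (f : Mor X X') (g : Mor Y Y') :
  (a *: f) \om g = a *: (f \om g).
Proof. by have := tensm_linl a f 0 g; rewrite tensm0l !addr0. Qed.

Lemma tensmDr X X' Y Y' (f : Mor X X') (g g' : Mor Y Y') :
  f \om (g + g') = (f \om g) + (f \om g').
Proof. by have := tensm_linr 1 f g g'; rewrite !scale1r. Qed.

Lemma tensm0r X X' Y Y' (f : Mor X X') : f \om (0 : Mor Y Y') = 0.
Proof. by apply: (addrI (f \om (0 : Mor Y Y'))); rewrite -tensmDr !addr0. Qed.

Lemma tensmZr X X' Y Y' a (f : Mor X X') (g : Mor Y Y') :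
  f \om (a *: g) = a *: (f \om g).
Proof. by have := tensm_linr a f g 0; rewrite tensm0r !addr0. Qed.

Lemma loop_inj (s s' : Mor munit munit) :
  (forall Y : C, lun Y \oc (s \om idmor Y) \oc lunV Y
                 = lun Y \oc (s' \om idmor Y) \oc lunV Y) -> s = s'.
Proof.
move=> /(_ munit) /(mcomp_can (lunK _)) /(mcomp_canl (lunK _)).
exact: whiskr_inj.
Qed.

End Monoidal.

(** * Multiplicativity of the pivotal trace *)

Section Rigid.
Local Open Scope cat_scope.
Variables (K : fieldType) (C : rigidcat K).
Implicit Types X Y Z W A V : C.

Lemma snake_dual V : snake (dbd V) (evd V) = idmor V.
Proof. by case: (dualP V). Qed.

Lemma zigzag_act V Y :
  (idmor V \om pact (evd V) Y) \oc cact (dbd V) (V \ot Y) = idmor (V \ot Y).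
Proof. by rewrite -snake_act snake_dual tensm_id. Qed.

Lemma mtranspose_act A V (e : Mor (A \ot V) munit) Y :
  mtranspose e \om idmor Y
  = pact e (ldual V \ot Y) \oc (idmor A \om cact (dbd V) Y).
Proof.
have -> : mtranspose e = pact e (ldual V) \oc (idmor A \om dbd V) \oc runV A by rewrite pactE.
rewrite -2!whiskr pact_tens !cactE -!whiskl.
by rewrite (compr (asc_nat _ _ _)) !mcompA (compr (triangleV _ _)).
Qed.

(** Naturality moves the evaluation of V past [e], where it meets the coevaluation
    of V and disappears by the zigzag. *)
Lemma evd_mtranspose A V (e : Mor (A \ot V) munit) :
  evd V \oc (mtranspose e \om idmor V) = e.
Proof.
apply: pact_inj => Y.
rewrite pact_comp tensm_id mtranspose_act mcompA -pact_nat (compr (whiskl _ _ _)).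
by rewrite zigzag_act tensm_id mcompm1.
Qed.

(** A transpose slides along a copairing and turns into the snake on the other
    strand; for a copairing dual to [e] that snake is the identity. *)
Lemma mtranspose_copair X A V (d : Mor munit (X \ot A)) (e : Mor (A \ot V) munit) :
  (idmor X \om mtranspose e) \oc d = (snake d e \om idmor (ldual V)) \oc dbd V.
Proof.
apply: cact_inj => Y.
rewrite !cact_comp tensm_id mtranspose_act snake_act -whiskl.
by rewrite -mcompA cact_nat mcompA.
Qed.

Lemma evd_dualm V W (f : Mor V W) :
  evd V \oc (dualm f \om idmor V) = evd W \oc (idmor (ldual W) \om f).
Proof. exact: evd_mtranspose. Qed.

Lemma dbd_dualm V W (f : Mor V W) :
  (idmor W \om dualm f) \oc dbd W = (f \om idmor (ldual V)) \oc dbd V.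
Proof.
rewrite /dualm mtranspose_copair; congr ((_ \om _) \oc _).
apply: whiskr_inj; rewrite snake_act pact_comp -whiskl -mcompA cact_nat mcompA.
by rewrite zigzag_act mcomp1m.
Qed.

(** The nested duality between [V W] and [W^* V^*]; its comparison with the chosen
    dual of [V W] is [dual_tens]. *)
Definition tens_pair V W : Mor ((ldual W \ot ldual V) \ot (V \ot W)) munit :=
  evd W \oc (idmor (ldual W) \om pact (evd V) W) \oc asc (ldual W) (ldual V) (V \ot W).

Definition tens_copair V W : Mor munit ((V \ot W) \ot (ldual W \ot ldual V)) :=
  ascV V W (ldual W \ot ldual V) \oc (idmor V \om cact (dbd W) (ldual V)) \oc dbd V.

Lemma tens_pair_act V W Y :
  pact (tens_pair V W) Y
  = pact (evd W) Y \oc (idmor (ldual W) \om pact (evd V) (W \ot Y))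
      \oc asc (ldual W) (ldual V) (V \ot (W \ot Y))
      \oc (idmor (ldual W \ot ldual V) \om asc V W Y).
Proof.
rewrite pactE [pact (evd W) Y]pactE -!whiskr -!mcompA; congr (_ \oc (_ \oc _)).
have -> : asc (ldual W) (ldual V) (V \ot W) \om idmor Y
    \oc ascV (ldual W \ot ldual V) (V \ot W) Y
  = ascV (ldual W) (ldual V \ot (V \ot W)) Y \oc (idmor _ \om ascV _ _ _) \oc asc _ _ _.
  apply: (mcomp_can (ascVK _ _ _)); rewrite (compr (ascK _ _ _)) mcompm1.
  by rewrite (compr (pentagon _ _ _ _)) !mcompA (compr (whiskl _ _ _)) ascK tensm_id
    mcompm1 ascK mcomp1m.
rewrite !mcompA -ascV_nat -!mcompA; congr (_ \oc _).
rewrite !mcompA !whiskl pact_tens (compr (ascVK _ _ _)) mcompm1.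
by rewrite -whiskl (compr (esym (asc_nat _ _ _))) tensm_id !mcompA.
Qed.

Lemma tens_copair_act V W Y :
  cact (tens_copair V W) Y
  = ascV V W ((ldual W \ot ldual V) \ot Y)
      \oc (idmor V \om (idmor W \om ascV (ldual W) (ldual V) Y))
      \oc (idmor V \om cact (dbd W) (ldual V \ot Y)) \oc cact (dbd V) Y.
Proof.
have H : (idmor V \om cact (dbd W) (ldual V)) \om idmor Y
    = ascV _ _ _ \oc (idmor V \om (cact (dbd W) (ldual V) \om idmor Y)) \oc asc _ _ _.
  by rewrite -mcompA -asc_nat mcompA ascK mcomp1m.
rewrite /tens_copair cactE -2!whiskr H cact_tens -2!whiskl !mcompA pentagonV.
by rewrite -!mcompA [asc V _ Y \oc _]mcompA -cactE.
Qed.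

Lemma snake_tens V W : snake (tens_copair V W) (tens_pair V W) = idmor (V \ot W).
Proof.
apply: whiskr_inj; rewrite snake_act tens_copair_act tensm_id.
move: munit => Y.
have H1 : pact (tens_pair V W) Y \oc ascV (ldual W) (ldual V) ((V \ot W) \ot Y)
  = pact (evd W) Y \oc (idmor (ldual W) \om
      (pact (evd V) (W \ot Y) \oc (idmor (ldual V) \om asc V W Y))).
  rewrite tens_pair_act -tensm_id (compr (esym (ascV_nat _ _ _))).
  by rewrite mcompA (compr (ascVK _ _ _)) mcompm1 (compr (whiskl _ _ _)).
have H2 : (idmor W \om (pact (tens_pair V W) Y \oc ascV _ _ _)) \oc cact (dbd W) _
  = pact (evd V) (W \ot Y) \oc (idmor (ldual V) \om asc V W Y).
  by rewrite H1 -whiskl -mcompA cact_nat mcompA zigzag_act mcomp1m.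
rewrite !mcompA -{1}[idmor (V \ot W)]tensm_id -ascV_nat.
rewrite (compr (whiskl _ _ _)) (compr (whiskl _ _ _)) (mcompA (idmor W \om _)) whiskl H2.
by rewrite -whiskl -!mcompA cact_nat [X in _ \oc X]mcompA zigzag_act mcomp1m ascK.
Qed.

Lemma dual_tensE V W : dual_tens V W = mtranspose (tens_pair V W).
Proof. by rewrite /tens_pair pactE. Qed.

Lemma dbd_tens V W :
  (idmor (V \ot W) \om dual_tens V W) \oc tens_copair V W = dbd (V \ot W).
Proof.
by rewrite dual_tensE mtranspose_copair snake_tens tensm_id mcomp1m.
Qed.

Lemma evd_tens V W :
  evd (V \ot W) \oc (dual_tens V W \om idmor (V \ot W)) = tens_pair V W.
Proof. by rewrite dual_tensE evd_mtranspose. Qed.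

(** The pivotal trace before the pivotal structure is inserted: [qdim j V] is the
    scalar of [ptr (piv j V)]. *)
Definition ptr V (f : Mor V (ldual (ldual V))) : Mor (munit : C) munit :=
  evd (ldual V) \oc (f \om idmor (ldual V)) \oc dbd V.

Lemma ptr_act V (f : Mor V (ldual (ldual V))) Y :
  pact (evd (ldual V)) Y \oc (f \om idmor _) \oc cact (dbd V) Y
  = lun Y \oc (ptr f \om idmor Y) \oc lunV Y.
Proof. by rewrite -loop_act pact_comp tensm_id. Qed.

Variable j : pivotal C.

(** The morphism [f] slides around the loop: through the coevaluation it becomes
    its dual, through the evaluation its double dual, which crosses the pivotal
    structure by naturality. *)
Lemma ptr_cyclic V W (f : Mor V W) (g : Mor W V) :
  ptr (piv j W \oc (f \oc g)) = ptr (piv j V \oc (g \oc f)).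
Proof.
rewrite /ptr [piv j V \oc _]mcompA -[in RHS]whiskr -[RHS]mcompA -[in RHS]mcompA.
rewrite -(dbd_dualm f) !mcompA (compr (esym (whisk_xchg _ _))) mcompA -evd_dualm.
by rewrite (compr (whiskr _ _ _)) mcompA -piv_nat.
Qed.

(** Since the pivotal structure is monoidal, the loop of [V W] can be drawn as a
    loop of [W] nested inside a loop of [V]; the inner loop is a scalar. *)
Lemma ptr_tens V W (c : K) : ptr (piv j W) = c *: idmor munit ->
  ptr (piv j (V \ot W)) = c *: ptr (piv j V).
Proof.
move=> cP.
have -> : ptr (piv j (V \ot W))
  = tens_pair (ldual W) (ldual V) \oc ((piv j V \om piv j W) \om idmor _)
     \oc tens_copair V W.
  (* slide dual_tens once around the loop, until it meets the pivotal structure *)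
  rewrite /ptr -dbd_tens mcompA (compr (esym (whisk_xchg _ _))).
  rewrite mcompA -evd_dualm (compr (whiskr _ _ _)) piv_tens -whiskr mcompA.
  by rewrite evd_tens.
have lP Y : pact (evd (ldual W)) Y \oc (piv j W \om idmor _) \oc cact (dbd W) Y
    = c *: idmor Y.
  by rewrite ptr_act cP tensmZl tensm_id mcompZr mcompZl mcompm1 lunVK.
apply: loop_inj => Y.
rewrite -loop_act pact_comp tensm_id tens_pair_act tens_copair_act.
rewrite tensmZl mcompZr mcompZl -ptr_act.
rewrite !mcompA (compr (whisk_xchg _ _)) !mcompA -[idmor (V \ot W)]tensm_id.
rewrite (compr (esym (ascV_nat _ _ _))) !mcompA.
rewrite (compr (whiskl _ _ _)) (compr (whiskl _ _ _)) (mcompA (idmor W \om _)).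
rewrite whiskl ascVK tensm_id mcomp1m (compr (asc_nat _ _ _)) !mcompA.
rewrite (compr (ascVK _ _ _)) mcompm1 2!(compr (esym (tensm_comp _ _ _ _))).
by rewrite !mcomp1m !mcompm1 mcompA lP tensmZr mcompZr mcompZl.
Qed.

End Rigid.

(** * Schur's lemma and quantum dimensions *)

Section Schur.
Local Open Scope cat_scope.
Import VectorInternalTheory.
Variables (K : numClosedFieldType) (C : lincat K).
Implicit Types X Y Z : C.
Hypothesis abC : abelian_category C.

Local Notation simple X := (@simple_object (cat_of C) X).

Lemma zero_objectP X : @is_zero_object (cat_of C) X <-> idmor X = 0.
Proof.
split=> [/(_ X)[[f [_ fP]] _]|id0 Y].
  by rewrite -(fP (idmor X) I) -(fP 0 I).
split; exists 0; split=> // f _; first by rewrite -(mcompm1 f) id0 mcomp0r.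
by rewrite -(mcomp1m f) id0 mcomp0l.
Qed.

Lemma simple_id_neq0 X : simple X -> idmor X != 0.
Proof. by case=> nz _; apply/eqP => /zero_objectP. Qed.

(** The kernel of [f] is a subobject of the simple object X, and it is not all of X;
    so it vanishes, [f] is mono, and simplicity of Y makes it invertible. *)
Lemma schur_iso X Y (f : Mor X Y) :
  simple X -> simple Y -> f != 0 -> @is_iso (cat_of C) X Y f.
Proof.
move=> sX sY f_neq0; case: abC => _ /(_ X Y f)[Z [k [fk0 kP]]] _ _ _.
have kmono : @is_mono (cat_of C) Z X k.
  move=> W g h /= e; have [|u [_ uP]] := kP W (k \oc g).
    by rewrite mcompA fk0 mcomp0l.
  by rewrite -(uP g) // -(uP h).
case: (sX.2 Z k kmono) => [/zero_objectP Z0|[k' [_ kk']]]; last first.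
  by case/eqP: f_neq0; rewrite -(mcompm1 f) -[idmor X]kk' /= mcompA fk0 mcomp0l.
have fmono : @is_mono (cat_of C) X Y f.
  move=> W g h /= e; have [|u [ku _]] := kP W (g - h).
    by rewrite mcompBr e subrr.
  by apply/subr0_eq; rewrite -ku -(mcomp1m u) Z0 mcomp0l mcomp0r.
case: (sY.2 X f fmono) => // /zero_objectP X0.
by case/eqP: (simple_id_neq0 sX).
Qed.

(** Composition with [f] is an endomorphism of a nonzero finite-dimensional space,
    so it has an eigenvector; then [f] minus the eigenvalue kills a nonzero
    morphism and cannot be invertible. *)
Lemma schur_scalar X (f : Mor X X) : simple X -> exists c, f = c *: idmor X.
Proof.
move=> sX; have id_neq0 := simple_id_neq0 sX; pose E := Mor X X.
pose phi := (@v2r _ E \o @postcomp _ C X X X f) \o @r2v _ E.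
have E_gt0 : (0 < dim E)%N.
  rewrite lt0n; apply: contra id_neq0 => /eqP E0; apply/eqP/v2r_inj.
  by apply/rowP => i; have := ltn_ord i; rewrite [X in (_ < X)%N]E0.
have [a /eigenvalueP[v vA v_neq0]] := eigenvalue_closed (lin1_mx phi) E_gt0.
have fv : f \oc r2v v = a *: r2v v.
  by rewrite -linearZ -vA mul_rV_lin1 /= v2rK.
exists a; apply/eqP; rewrite -subr_eq0; apply: contraNT v_neq0.
move=> /(schur_iso sX sX)[g [/= gf _]]; rewrite -(r2vK v) -(mcomp1m (r2v v)) -gf.
by rewrite -mcompA mcompBl mcompZl mcomp1m fv subrr mcomp0r linear0.
Qed.

Lemma scalar_ofZ X c : idmor X != 0 -> scalar_of (c *: idmor X) = c.
Proof.
move=> nz; rewrite /scalar_of linearZ /=.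
by rewrite (coord_free ord0 ord0 (X := [tuple idmor X])) ?mulr1 // seq1_free.
Qed.

Lemma scalar_ofK X (f : Mor X X) : simple X -> scalar_of f *: idmor X = f.
Proof.
move=> sX; have [c ->] := schur_scalar f sX.
by rewrite scalar_ofZ // simple_id_neq0.
Qed.

Lemma simple_hom0 X Y : simple X -> simple Y -> ~ @isomorphic (cat_of C) X Y ->
  forall f : Mor X Y, f = 0.
Proof.
move=> sX sY nXY f; apply/eqP/negPn/negP => f_neq0; apply: nXY.
by exists f; apply: schur_iso.
Qed.

(** By Schur's lemma every morphism to [S b] factors through the only summand
    [S b], so the projection onto it spans. *)
Lemma dim_hom_class (B : finType) (S : B -> C) X (n : B -> nat) b :
  @simple_reps (cat_of C) B S -> has_class S X n -> n b = 1%N ->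
  \dim {: Mor X (S b)} = 1%N.
Proof.
move=> [sS injS _] [inj [prj [prjK _ sumE]]] nb1.
have nb_gt0 : (0 < n b)%N by rewrite nb1.
pose t : {b : B & 'I_(n b)} := Tagged (fun b => 'I_(n b)) (Ordinal nb_gt0).
have t_uniq s : tag s = b -> s = t.
  case: s => b' i /= e; subst b'; congr existT; apply: val_inj => /=.
  by case: i => [[|i]] //=; rewrite {1}nb1.
have spanE : {: Mor X (S b)}%VS = <[prj t : Mor X (S b)]>%VS.
  apply/esym/eqP; rewrite eqEsubv subvf /=; apply/subvP => f _.
  have -> : f = \sum_s ((f \oc inj s) \oc prj s).
    rewrite -[LHS]mcompm1 -sumE mcomp_sumr; apply: eq_bigr => s _.
    by rewrite mcompA.
  apply: memv_suml => s _; have [/t_uniq ->|sb] := eqVneq (tag s) b.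
    by have [c ->] := schur_scalar (f \oc inj t) (sS b); rewrite mcompZl mcomp1m memvZ ?memv_line.
  by rewrite (simple_hom0 _ _ _ (f \oc inj s)) ?mcomp0l ?mem0v // => /injS; apply/eqP.
rewrite spanE dim_vline; case: eqVneq => // p0.
by have /eqP[] := simple_id_neq0 (sS b); rewrite -(prjK t) [X in X \oc _]p0 mcomp0l.
Qed.

Lemma dim_hom_simple0 X Y Z : @isomorphic (cat_of C) X Y -> simple Y -> simple Z ->
  ~ @isomorphic (cat_of C) Y Z -> \dim {: Mor X Z} = 0%N.
Proof.
move=> [u [v [/= vu uv]]] sY sZ nYZ; apply/eqP; rewrite dimv_eq0; apply/eqP.
apply/eqP; rewrite -subv0; apply/subvP => f _; rewrite memv0; apply/eqP.
by rewrite -(mcompm1 f) -vu mcompA (simple_hom0 sY sZ nYZ (f \oc v)) mcomp0l.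
Qed.

End Schur.

Section QuantumDim.
Local Open Scope cat_scope.
Variables (K : numClosedFieldType) (C : fusioncat K) (j : pivotal C).
Implicit Types V W X : C.

Let abC : abelian_category C := fusion_abelian C.
Let unit_simple : @simple_object (cat_of C) munit := fusion_unit C.

Lemma ptr_qdim V : ptr (piv j V) = qdim j V *: idmor munit.
Proof. by rewrite /qdim scalar_ofK. Qed.

Lemma qdim_tens V W : qdim j (V \ot W) = qdim j V * qdim j W.
Proof.
rewrite -[LHS](@scalar_ofZ _ C munit) ?simple_id_neq0 // -ptr_qdim.
rewrite (ptr_tens V (ptr_qdim W)) ptr_qdim scalerA scalar_ofZ ?simple_id_neq0 //.
exact: mulrC.
Qed.

(** Cyclicity turns the trace of each idempotent [inj \oc prj] into the trace of
    the identity of the summand. *)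
Lemma qdim_dsum (T : finType) (F : T -> C) X :
  is_dsum F X -> qdim j X = \sum_t qdim j (F t).
Proof.
move=> [inj [prj [prjK _ sumE]]].
rewrite -[LHS](@scalar_ofZ _ C munit) ?simple_id_neq0 // -ptr_qdim.
suff -> : ptr (piv j X) = (\sum_t qdim j (F t)) *: idmor munit.
  by rewrite scalar_ofZ ?simple_id_neq0.
rewrite scaler_suml; under eq_bigr do rewrite -ptr_qdim.
rewrite -[piv j X]mcompm1 -sumE mcomp_sumr.
rewrite /ptr [X in _ \oc X \oc _](_ : _ =
  \sum_t ((piv j X \oc (inj t \oc prj t)) \om idmor (ldual X))).
  rewrite mcomp_sumr mcomp_suml; apply: eq_bigr => t _.
  by rewrite -/(ptr _) ptr_cyclic prjK mcompm1.
by elim/big_rec2: _ => [|t y1 y2 _ <-]; rewrite ?tensm0l ?tensmDl.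
Qed.

Lemma qdim_class (B : finType) (S : B -> C) X (n : B -> nat) :
  has_class S X n -> qdim j X = \sum_b (n b)%:R * qdim j (S b).
Proof.
move/qdim_dsum ->.
rewrite -(@sig_big_dep _ _ _ _ _ xpredT (fun _ => xpredT) (fun b i => qdim j (S b))) /=.
by apply: eq_bigr => b _; rewrite sumr_const card_ord mulr_natl.
Qed.

End QuantumDim.

(** * Dimensions in a Haagerup-Izumi category *)

Lemma sum_delta (K : pzSemiRingType) (B : finType) (F : B -> K) x :
  \sum_z (z == x)%:R * F z = F x.
Proof.
rewrite (bigD1 x) //= eqxx mul1r big1 ?addr0 // => z /negPf ->.
by rewrite mul0r.
Qed.

Section HaagerupIzumiDim.
Variables (K : numClosedFieldType) (gT : finGroupType).
Variables (C : fusioncat K) (j : spherical C) (S : HIbasis gT -> C).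
Hypotheses (oddG : odd #|gT|) (CHI : is_HI S).
Let d : K := qdim j (S (inr 1%g)).
Hypothesis d_gt0 : 0 < d.

Local Notation n := (#|gT|%:R : K).

Lemma qdim_HImul x y :
  qdim j (S x) * qdim j (S y) = \sum_z (HImul x y z)%:R * qdim j (S z).
Proof. by case: CHI => _ _ /(_ x y)/(qdim_class j); rewrite qdim_tens. Qed.

(** Comparing [g rho] with [rho g = g^-1 rho] shows that the dimension of [g] is a
    square root of 1; being also a root of unity of odd order, it is 1. *)
Lemma qdim_inl g : qdim j (S (inl g)) = 1.
Proof.
pose a g := qdim j (S (inl g)); rewrite -/(a g).
have aM x y : a x * a y = a (x * y)%g by rewrite /a qdim_HImul sum_delta.
have ad x : a x * d = qdim j (S (inr x)) by rewrite /a /d qdim_HImul sum_delta mulg1.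
have da x : d * a x = qdim j (S (inr x^-1%g)) by rewrite /a /d qdim_HImul sum_delta mulg1.
have d_neq0 : d != 0 by rewrite gt_eqF.
have a1 : a 1%g = 1 by apply: (mulIf d_neq0); rewrite ad mul1r.
have aV x : a x^-1%g = a x by apply: (mulIf d_neq0); rewrite ad -da mulrC.
have a2 x : a x ^+ 2 = 1 by rewrite expr2 -{2}aV aM mulgV.
have aX x k : a x ^+ k = a (x ^+ k)%g.
  by elim: k => [|k IHk]; rewrite ?expr0 ?a1 // exprS IHk aM expgS.
have gn : (g ^+ #|gT| = 1)%g by rewrite -cardsT (@expg_cardG _ [set: gT]%G) ?inE.
have := aX g #|gT|; rewrite gn a1 -[#|gT|]odd_double_half oddG -muln2 mulnC.
by rewrite exprD exprM a2 expr1n mulr1.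
Qed.

Lemma qdim_inr g : qdim j (S (inr g)) = d.
Proof.
have : qdim j (S (inl g)) * d = qdim j (S (inr g)).
  by rewrite /d qdim_HImul sum_delta mulg1.
by rewrite qdim_inl mul1r.
Qed.

Lemma qdim_rho_sqr : d ^+ 2 = 1 + n * d.
Proof.
rewrite expr2 {1 2}/d qdim_HImul big_sumType /=; congr (_ + _).
  under eq_bigr => g _ do
    rewrite big1 // addn0 invg1 mulg1 (inj_eq (@inl_inj _ _)) qdim_inl.
  by rewrite (sum_delta (fun=> 1)).
under eq_bigr => g _.
  rewrite qdim_inr add0n (bigD1 g) //= eqxx big1 ?addn0 ?mul1r; last first.
    by move=> h hg; rewrite (inj_eq (@inr_inj _ _)) eq_sym (negPf hg).
  over.
by rewrite sumr_const mulr_natl.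
Qed.

Lemma global_dim_HI : global_dim j S = n * (2 + n * d).
Proof.
rewrite /global_dim big_sumType /=.
under eq_bigr do rewrite qdim_inl expr1n.
under [X in _ + X]eq_bigr do rewrite qdim_inr.
rewrite !sumr_const qdim_rho_sqr -[X in _ + X]mulr_natl; ring.
Qed.

Lemma qdim_plus_Grho X (f : gT -> nat) : has_class S X (plus_Grho f) ->
  qdim j X = (\sum_g f g)%:R + n * d.
Proof.
move/(qdim_class j) ->; rewrite big_sumType /= natr_sum; congr (_ + _).
  by apply: eq_bigr => g _; rewrite qdim_inl mulr1.
by under eq_bigr do rewrite qdim_inr mul1r; rewrite sumr_const mulr_natl.
Qed.

(** Here [2 d - n = d + d^-1], so positivity of [d] selects the root
    [d = (n + sqrt (n^2 + 4)) / 2] of [d^2 = 1 + n d]. *)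
Lemma sqrt_discriminant N : N = (#|gT| ^ 2 + 4)%N -> sqrtC N%:R = 2 * d - n.
Proof.
move=> ->; have dn : d - n = d^-1.
  have d_neq0 : d != 0 by rewrite gt_eqF.
  by apply: (mulIf d_neq0); rewrite mulVf // mulrBl -expr2 qdim_rho_sqr addrK.
have pos : 0 <= 2 * d - n.
  have -> : 2 * d - n = d + d^-1 by rewrite -dn; ring.
  by rewrite ltW // addr_gt0 ?invr_gt0.
rewrite -[RHS]sqrCK //; congr sqrtC; rewrite natrD natrX.
have -> : (2 * d - n) ^+ 2 = n ^+ 2 + 4 * (d ^+ 2 - n * d) by ring.
by rewrite qdim_rho_sqr; ring.
Qed.

End HaagerupIzumiDim.

(** * Linear characters of a finite abelian group *)

Section LinearCharacters.
Variables (K : numClosedFieldType) (gT : finGroupType).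
Implicit Types phi psi : {ffun gT -> K}.

Local Notation n := (#|gT|%:R : K).

Lemma lin_charX phi k g : lin_char phi -> phi (g ^+ k)%g = phi g ^+ k.
Proof.
case=> phi1 phiM; elim: k => [|k IHk]; first by rewrite expg0 phi1.
by rewrite expgS phiM IHk exprS.
Qed.

Lemma lin_char_neq0 phi g : lin_char phi -> phi g != 0.
Proof.
case=> phi1 phiM; apply/eqP => phig0; have := oner_neq0 K.
by rewrite -phi1 -(mulgV g) phiM phig0 mul0r eqxx.
Qed.

Lemma lin_charV phi g : lin_char phi -> phi g^-1%g = (phi g)^-1.
Proof.
move=> phiP; have [phi1 phiM] := phiP.
by apply: (mulIf (lin_char_neq0 g phiP)); rewrite -phiM mulVg phi1 mulVf ?lin_char_neq0.
Qed.

Lemma lin_char_exp_card phi g : lin_char phi -> phi g ^+ #|gT| = 1.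
Proof.
move=> phiP; rewrite -lin_charX // -cardsT (@expg_cardG _ [set: gT]%G) ?inE //.
by case: phiP.
Qed.

Lemma lin_char_conj phi g : lin_char phi -> (phi g)^* = (phi g)^-1.
Proof.
move=> phiP; apply: (mulfI (lin_char_neq0 g phiP)).
rewrite mulfV ?lin_char_neq0 // -normCK.
have n_gt0 : (0 < #|gT|)%N by rewrite (cardD1 1%g).
suff -> : `|phi g| = 1 by rewrite expr1n.
by apply/eqP; rewrite -(pexpr_eq1 n_gt0) // -normrX lin_char_exp_card // normr1.
Qed.

Definition conj_char phi : {ffun gT -> K} := [ffun g => (phi g)^*].

Lemma conj_charP phi : lin_char phi -> lin_char (conj_char phi).
Proof.
by case=> phi1 phiM; split=> [|g h]; rewrite !ffunE ?phi1 ?rmorph1 // phiM rmorphM.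
Qed.

Lemma conj_charK : involutive conj_char.
Proof. by move=> phi; apply/ffunP => g; rewrite !ffunE conjCK. Qed.

Lemma conj_char1 : conj_char [ffun=> 1] = [ffun=> 1].
Proof. by apply/ffunP => g; rewrite !ffunE rmorph1. Qed.

(** A real-valued character takes square roots of 1 as values, and these have odd
    order. *)
Lemma conj_char_fixed phi : odd #|gT| -> lin_char phi ->
  conj_char phi = phi -> phi = [ffun=> 1].
Proof.
move=> oddG phiP /ffunP realphi; apply/ffunP => g; rewrite ffunE.
have phi2 : phi g ^+ 2 = 1.
  by rewrite expr2 -{2}realphi ffunE lin_char_conj // mulfV ?lin_char_neq0.
have := lin_char_exp_card g phiP; rewrite -[#|gT|]odd_double_half oddG -muln2 mulnC.
by rewrite exprD exprM phi2 expr1n mulr1.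
Qed.

(** Orthogonality: translating by [g] multiplies the sum by [phi g / psi g]. *)
Lemma lin_char_sum phi psi : lin_char phi -> lin_char psi ->
  \sum_g phi g * psi g^-1%g = n * (phi == psi)%:R.
Proof.
move=> phiP psiP; have [-> | neq] := eqVneq phi psi.
  under eq_bigr do rewrite lin_charV // mulfV ?lin_char_neq0 //.
  by rewrite sumr_const mulr1.
have [g phig] : exists g, phi g != psi g.
  apply/existsP; apply: contraNT neq; rewrite negb_exists => /forallP e.
  by apply/eqP/ffunP => g; apply/eqP/negPn.
rewrite mulr0; apply/eqP.
set s := \sum_g _; have : (phi g - psi g) * s = 0.
  apply/eqP; rewrite mulrBl subr_eq0; apply/eqP.
  rewrite /s mulr_sumr (reindex_inj (mulgI g^-1%g)) mulr_sumr; apply: eq_bigr => h _ /=.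
  case: (phiP) (psiP) => _ phiM [_ psiM].
  by rewrite mulrA -phiM mulKVg invMg invgK psiM mulrA mulrC.
by move=> /eqP; rewrite mulf_eq0 subr_eq0 (negPf phig).
Qed.

Lemma tr_mulmx1 m (A B : 'M[K]_m) : m = 1%N -> \tr (A *m B) = \tr A * \tr B.
Proof.
move=> m1; subst m; rewrite [A]mx11_scalar [B]mx11_scalar -scalar_mxM.
by rewrite !mxtrace_scalar !mulr1n.
Qed.

Lemma trace_regular g :
  \tr (regular_repr K [set: gT]%G g) = n * (g == 1%g)%:R.
Proof.
rewrite /mxtrace; under eq_bigr => i _.
  rewrite !mxE eqxx /=.
  have -> : (i == gring_index [set: gT] (enum_val i * g)%g) = (g == 1%g).
    rewrite -(inj_eq enum_val_inj) gring_indexK ?inE //.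
    by rewrite -{1}[enum_val i]mulg1 (inj_eq (mulgI _)) eq_sym.
  over.
by rewrite /= sumr_const card_ord /gcard /= cardsT mulr_natl.
Qed.

(** The irreducible constituents of the regular representation, which all have
    degree one, so that its trace is their sum. Pairing this sum with a character
    psi and using orthogonality shows that psi occurs exactly once. *)
Lemma lin_char_basis : abelian [set: gT] ->
  exists (J : finType) (chi : J -> {ffun gT -> K}),
    [/\ forall a, lin_char (chi a),
        forall g, \sum_a chi a g = n * (g == 1%g)%:R &
        forall psi, lin_char psi -> (\sum_a (chi a == psi) = 1)%N].
Proof.
move=> abelG; pose G := [set: gT]%G.
have sG : irrType K G := DecSocleType (regular_repr K G).
have splitG : group_splitting_field K G := @group_closure_closed_field K gT G.
have n_neq0 : n != 0 by rewrite pnatr_eq0 -lt0n (cardD1 1%g).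
have charG : ([pchar K]^'.-group G)%g.
  by apply: sub_in_pnat (pnat_pi (cardG_gt0 G)) => p _ _; rewrite inE /= pchar_num.
have deg1 (i : sG) : irr_degree i = 1%N by apply: irr_degree_abelian.
pose chi (i : sG) : {ffun gT -> K} := [ffun g => \tr (irr_repr i g)].
have chiP i : lin_char (chi i).
  split=> [|g h]; rewrite !ffunE; first by rewrite repr_mx1 mxtrace1 deg1.
  by rewrite repr_mxM ?inE // tr_mulmx1 // deg1.
have chi_sum g : \sum_i chi i g = n * (g == 1%g)%:R.
  rewrite -trace_regular (mxtrace_regular_pchar sG) ?inE //.
  by apply: eq_bigr => i _; rewrite ffunE [X in _ *+ X]deg1.
exists sG, chi; split=> // psi psiP.
have : \sum_i \sum_g chi i g * psi g^-1%g = n.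
  rewrite exchange_big /= (bigD1 1%g) //= -mulr_suml chi_sum eqxx invg1 psiP.1 !mulr1.
  rewrite big1 ?addr0 // => g g1.
  by rewrite -mulr_suml chi_sum (negPf g1) mulr0 mul0r.
rewrite (eq_bigr (fun i => n * (chi i == psi)%:R)) => [|i _]; last exact: lin_char_sum.
rewrite -mulr_sumr -natr_sum -[RHS]mulr1 => /(mulfI n_neq0)/eqP.
by rewrite pnatr_eq1 => /eqP.
Qed.

End LinearCharacters.

(** * Quadratic phases and sums over inverse pairs *)

Section ExpQZ.
Variable R : realType.

Definition cis (t : R) : R[i] := Complex (cos t) (sin t).

Lemma cisD s t : cis (s + t) = cis s * cis t.
Proof. by rewrite /cis cosD sinD [sin s * cos t + _]addrC; simpc. Qed.

Lemma cis0 : cis 0 = 1.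
Proof. by rewrite /cis cos0 sin0. Qed.

Lemma cis_int (m : int) : cis (2 * pi * m%:~R) = 1.
Proof.
have cisn (k : nat) : cis (2 * pi * k%:R) = 1.
  elim: k => [|k IHk]; first by rewrite mulr0 cis0.
  rewrite -[k.+1%:R]natr1 mulrDr mulr1 cisD IHk mul1r /cis mulr_natl.
  by rewrite cos2pi sin2pi.
case: m => k; first exact: cisn.
have := cisD (2 * pi * (Negz k)%:~R) (2 * pi * k.+1%:R).
rewrite (cisn k.+1).
by rewrite mulr1 -mulrDr NegzE mulrNz addNr mulr0 cis0 => <-.
Qed.

Lemma repr_QmodZD (x y : QmodZ) :
  exists m : int, repr (x + y) = repr x + repr y + m%:~R :> rat.
Proof.
have : (repr (x + y) == repr x + repr y %[mod QmodZ])%qT.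
  by apply/eqP; rewrite reprK [RHS]Quotient.pi_add;
    exact: (congr2 _ (esym (reprK x)) (esym (reprK y))).
rewrite -Quotient.idealrBE => /intrP[m mP]; exists m; rewrite -mP.
by rewrite [RHS]addrC subrK.
Qed.

(** The chosen representatives are additive up to an integer, which the period
    of the exponential absorbs. *)
Lemma expQZD x y : expQZ R (x + y) = expQZ R x * expQZ R y.
Proof.
rewrite /expQZ -/(cis _) -/(cis (2 * pi * ratr (repr x))) -/(cis (2 * pi * ratr (repr y))).
have [m ->] := repr_QmodZD x y.
rewrite !rmorphD /= ratr_int; move: (2 * pi) (cis_int m) => t tm.
by rewrite !mulrDr !cisD tm mulr1.
Qed.

Lemma expQZ0 : expQZ R 0 = 1.
Proof.
have /eqP := expQZD 0 0.
rewrite addr0 -subr_eq0 -{1}[expQZ R 0]mulr1 -mulrBr mulf_eq0 subr_eq0.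
case/orP => [|/eqP <- //]; rewrite /expQZ -/(cis _) => /eqP c0.
have := cisD (2 * pi * ratr (repr (0 : QmodZ))) (- (2 * pi * ratr (repr (0 : QmodZ)))).
by rewrite subrr cis0 c0 mul0r => /eqP; rewrite oner_eq0.
Qed.

Lemma expQZMn x k : expQZ R (x *+ k) = expQZ R x ^+ k.
Proof.
elim: k => [|k IHk]; first by rewrite expQZ0.
by rewrite mulrS expQZD IHk exprS.
Qed.

End ExpQZ.

Lemma quadratic_form1 (hT : finGroupType) (q : hT -> QmodZ) :
  quadratic_form q -> q 1%g = 0.
Proof.
case=> _ _ polarMl _; have := polarMl 1%g 1%g 1%g.
rewrite !mulg1 => /(congr1 (fun z => z - polar q 1%g 1%g)).
rewrite subrr addrK /polar mulg1 subrr sub0r => /eqP.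
by rewrite eq_sym oppr_eq0 => /eqP.
Qed.

Section InverseOrbits.
Variable gT : finGroupType.
Hypothesis oddG : odd #|gT|.

Lemma odd_invg_neq (g : gT) : g != 1%g -> g^-1%g != g.
Proof.
apply: contra => /eqP gV; rewrite -order_eq1.
have g2 : (g ^+ 2 = 1)%g by rewrite expgS expg1 -{1}gV mulVg.
have : (#[g]%g %| gcdn 2 #|gT|)%N.
  by rewrite dvdn_gcd order_dvdn g2 eqxx -cardsT order_dvdG ?inE.
have -> : gcdn 2 #|gT| = 1%N by apply/eqP; rewrite -/(coprime _ _) coprime2n.
by rewrite dvdn1.
Qed.

(** Inversion exchanges H with the rest of the non-identity elements. *)
Lemma sum_half_system (K : numFieldType) (H : {set gT}) (F : gT -> K) :
  (forall h, (h \in H) = (h != 1%g) && (h^-1%g \notin H)) ->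
  (forall h, F h^-1%g = F h) ->
  \sum_(h in H) F h = 2^-1 * (\sum_h F h - F 1%g).
Proof.
move=> HP FV; rewrite [\sum_h F h](bigD1 1%g) //= [F 1%g + _]addrC addrK.
rewrite [in RHS](bigID (mem H)) /=.
have -> : \sum_(h | (h != 1%g) && (h \in H)) F h = \sum_(h in H) F h.
  by apply: eq_bigl => h; rewrite [h \in H]HP andbA andbb.
have -> : \sum_(h | (h != 1%g) && (h \notin H)) F h = \sum_(h in H) F h.
  rewrite (reindex_inj invg_inj) /=; apply: eq_big => h; last by rewrite FV.
  by rewrite [RHS]HP invg_eq1.
by field.
Qed.

(** Each fibre of [idx] on the non-identity elements is a pair [h, h^-1], and
    these two are distinct because the order is odd. *)
Lemma sum_two_to_one (K : numFieldType) (L : finType) (idx : gT -> L) (F : L -> K) :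
  (forall l, exists2 h, h <> 1%g & idx h = l) ->
  (forall h h', h <> 1%g -> h' <> 1%g -> idx h = idx h' <-> h = h' \/ h = h'^-1%g) ->
  \sum_l F l = 2^-1 * \sum_(h | h != 1%g) F (idx h).
Proof.
move=> idx_surj idx_eq; rewrite (partition_big idx xpredT) //= mulr_sumr.
apply: eq_bigr => l _; have [h /eqP h1 hl] := idx_surj l.
rewrite (eq_bigr (fun=> F l)) => [|h' /andP[_ /eqP ->]] //.
rewrite (eq_bigl (mem [set h; h^-1%g])) => [|h' /=]; last first.
  rewrite !inE; apply/andP/orP => [[/eqP h'1 /eqP h'l]|hh'].
    have /idx_eq[//||->|->] : idx h' = idx h by rewrite h'l.
    - exact/eqP.
    - by left.
    - by right.
  have h'1 : h' != 1%g by case: hh' => /eqP ->; rewrite ?invg_eq1.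
  split=> //; rewrite -hl; apply/eqP/idx_eq; [exact/eqP|exact/eqP|].
  by case: hh' => /eqP ->; [left | right].
by rewrite sumr_const cards2 eq_sym odd_invg_neq // -[X in _ * X]mulr_natl /= mulKf // pnatr_eq0.
Qed.

End InverseOrbits.

(** * Sums over the simple objects of the center *)

Section CenterSum.
Variables (F : numClosedFieldType) (gT : finGroupType) (C : fusioncat F).
Variables (S : HIbasis gT -> C) (I : finType) (X : I -> drinfeld_center C).
Variables (theta : I -> F) (Z : EG_center S X theta).
Hypothesis oddG : odd #|gT|.
Variables (J : finType) (chi : J -> {ffun gT -> F}).
Hypothesis chiP : forall a, lin_char (chi a).
Hypothesis chi_once : forall psi, lin_char psi -> (\sum_a (chi a == psi) = 1)%N.

Local Notation triv := ([ffun=> 1] : {ffun gT -> F}).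
Local Notation reps := (zreps Z).

Lemma natr_chi_once psi : lin_char psi -> \sum_a (chi a == psi)%:R = 1 :> F.
Proof. by move=> psiP; rewrite -natr_sum chi_once. Qed.

Lemma neqP (i i' : I) : i <> i' -> (i == i') = false.
Proof. by move/eqP/negPf. Qed.

Lemma neq_symP (i i' : I) : i <> i' -> (i' == i) = false.
Proof. by rewrite eq_sym; apply: neqP. Qed.

(** The terms for [A_psi] carry the factor 1/2 because psi and its conjugate give
    the same object. *)
Definition index_weight (i : I) : F :=
  (i == z1 Z)%:R + (i == zB Z)%:R
  + 2^-1 * (\sum_(a | chi a != triv) (i == zA Z (chi a))%:R)
  + \sum_(h in reps) \sum_a (i == zC Z h (chi a))%:R
  + \sum_l (i == zD Z l)%:R.

(** For [i = A_psi] the two characters psi and its conjugate, which differ because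
    the order of G is odd, contribute one half each. *)
Lemma index_weight1 i : index_weight i = 1.
Proof.
have chiN a : chi a != triv -> chi a <> triv by move/eqP.
rewrite /index_weight.
case: (z_exhaust Z i) => [->|[->|[[psi [psiP psi1 ->]]|[[h [phi [hP phiP ->]]]|[l ->]]]]].
- rewrite eqxx (neqP (z_1B (e:=Z))) [X in 2^-1 * X]big1 ?mulr0 => [|a /chiN a1]; last first.
    by rewrite neqP //; apply: z_1A.
  rewrite [X in _ + X + _]big1 => [|h hP]; last first.
    by rewrite big1 // => a _; rewrite neqP //; apply: z_1C.
  rewrite big1 ?addr0 // => l _; rewrite neqP //; exact: z_1D.
- rewrite eqxx (neq_symP (z_1B (e:=Z))) [X in 2^-1 * X]big1 ?mulr0 => [|a /chiN a1]; last first.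
    by rewrite neqP //; apply: z_BA.
  rewrite [X in _ + X + _]big1 => [|h hP]; last first.
    by rewrite big1 // => a _; rewrite neqP //; apply: z_BC.
  rewrite big1 ?addr0 ?add0r // => l _; rewrite neqP //; exact: z_BD.
- rewrite (neq_symP (z_1A psiP psi1)) (neq_symP (z_BA psiP psi1)) !add0r.
  rewrite [X in _ + X + _]big1 => [|h hP]; last first.
    by rewrite big1 // => a _; rewrite neqP //; apply: z_AC.
  rewrite [X in _ + X]big1 ?addr0 => [|l _]; last by rewrite neqP //; apply: z_AD.
  have cpsiP := conj_charP psiP.
  have cpsi1 : conj_char psi <> triv.
    by move=> e; apply: psi1; rewrite -[psi]conj_charK e conj_char1.
  have cpsi_psi : conj_char psi != psi.
    by apply/eqP => e; apply: psi1; apply: conj_char_fixed.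
  rewrite big_mkcond (eq_bigr (fun a => (chi a == psi)%:R + (chi a == conj_char psi)%:R)).
    by rewrite big_split /= !natr_chi_once // mulVf ?pnatr_eq0.
  move=> a _; case: ifPn => [/chiN a1|/negPn/eqP ->].
    have [e|/eqP n1] := eqVneq (chi a) psi.
      by rewrite e eqxx eq_sym (negPf cpsi_psi) addr0.
    have [e|/eqP n2] := eqVneq (chi a) (conj_char psi).
      rewrite (_ : _ == _) ?add0r //; apply/eqP/z_A_eq => //; by right.
    by rewrite addr0 neqP // => /z_A_eq[] // /esym.
  by rewrite !(eq_sym triv) (introF eqP psi1) (introF eqP cpsi1) addr0.
- rewrite (neq_symP (z_1C hP phiP)) (neq_symP (z_BC hP phiP)) !add0r.
  rewrite [X in 2^-1 * X]big1 ?mulr0 ?add0r => [|a /chiN a1]; last first.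
    by rewrite neq_symP //; apply: z_AC.
  rewrite [X in _ + X]big1 ?addr0 => [|l _]; last by rewrite neqP //; apply: z_CD.
  rewrite (bigD1 h) //= [X in _ + X]big1 ?addr0 => [|h' /andP[h'P h'h]]; last first.
    rewrite big1 // => a _; rewrite neqP // => /z_C_inj[] // e _.
    by rewrite e eqxx in h'h.
  rewrite -[RHS](natr_chi_once phiP); apply: eq_bigr => a _; congr (_%:R); congr nat_of_bool.
  by apply/eqP/eqP => [/z_C_inj[]//|->].
- rewrite (neq_symP (z_1D (e:=Z) (l:=l))) (neq_symP (z_BD (e:=Z) (l:=l))) !add0r.
  rewrite [X in 2^-1 * X]big1 ?mulr0 ?add0r => [|a /chiN a1]; last first.
    by rewrite neq_symP //; apply: z_AD.
  rewrite [X in X + _]big1 ?add0r => [|h hP]; last first.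
    by rewrite big1 // => a _; rewrite neq_symP //; apply: z_CD.
  by rewrite (bigD1 l) //= eqxx big1 ?addr0 // => l' l'l;
    rewrite (inj_eq (z_D_inj (e:=Z))) eq_sym (negPf l'l).
Qed.

Lemma sum_center (f : I -> F) :
  \sum_i f i = f (z1 Z) + f (zB Z) + 2^-1 * (\sum_(a | chi a != triv) f (zA Z (chi a)))
    + \sum_(h in reps) \sum_a f (zC Z h (chi a)) + \sum_l f (zD Z l).
Proof.
have pick x : \sum_i (i == x)%:R * f i = f x by apply: sum_delta.
have swap (A : finType) (P : pred A) (w : A -> I -> F) :
    \sum_i (\sum_(a | P a) w a i) * f i = \sum_(a | P a) \sum_i w a i * f i.
  by rewrite exchange_big /=; apply: eq_bigr => i _; rewrite mulr_suml.
have swap1 (A : finType) (P : pred A) (x : A -> I) :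
    \sum_i (\sum_(a | P a) (i == x a)%:R) * f i = \sum_(a | P a) f (x a).
  by rewrite swap; apply: eq_bigr => a _; apply: pick.
rewrite (eq_bigr (fun i => index_weight i * f i)) => [|i _]; last by rewrite index_weight1 mul1r.
under eq_bigr do rewrite /index_weight !mulrDl -mulrA.
rewrite !big_split /= !pick -mulr_sumr; congr (_ + _ * _ + _ + _).
- exact: swap1.
- by rewrite swap; apply: eq_bigr => h _; apply: swap1.
- exact: swap1.
Qed.

End CenterSum.

(** * The indicator of rho *)

Lemma isomorphic_trans (C : category) (X Y Z : C) :
  isomorphic X Y -> isomorphic Y Z -> isomorphic X Z.
Proof.
move=> [f [f' [f'f ff']]] [g [g' [g'g gg']]].
exists (ccomp g f), (ccomp f' g'); split.
  by rewrite ccompA -(ccompA f') g'g ccompm1 f'f.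
by rewrite ccompA -(ccompA g) ff' ccompm1 gg'.
Qed.

Section CenterSumRho.
Variables (K : numClosedFieldType) (gT : finGroupType).
Variables (C : fusioncat K) (j : spherical C) (S : HIbasis gT -> C).
Hypotheses (abelG : abelian [set: gT]) (oddG : odd #|gT|) (CHI : is_HI S).
Let rho := S (inr 1%g).
Let d : K := qdim j rho.
Hypothesis d_gt0 : 0 < d.
Variables (I : finType) (X : I -> drinfeld_center C) (theta : I -> K).
Variable Z : EG_center S X theta.
Local Notation n := (#|gT|%:R : K).
Local Notation qdimF i := (qdim j (forget (X i))).
Local Notation homF i := ((\dim {: Mor (forget (X i)) rho})%:R : K).

Lemma sum_nat_delta (g : gT) : (\sum_h (h == g) = 1)%N.
Proof.
by rewrite (bigD1 g) //= eqxx big1 ?addn0 // => h /negPf ->.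
Qed.

Lemma hom_z1 : homF (z1 Z) = 0.
Proof.
have [repsS unitS _] := CHI; have [simpleS injS _] := repsS.
rewrite (dim_hom_simple0 (fusion_abelian C) (forget_1 Z) (fusion_unit C) (simpleS _)) //.
by move=> /(isomorphic_trans unitS)/injS.
Qed.

Lemma class_weight i (f : gT -> nat) : has_class S (forget (X i)) (plus_Grho f) ->
  qdimF i * homF i = (\sum_g f g)%:R + n * d.
Proof.
move=> clX; have [repsS _ _] := CHI.
by rewrite (dim_hom_class (fusion_abelian C) repsS clX) // mulr1
  (qdim_plus_Grho oddG CHI _ clX).
Qed.

Lemma weight_B : qdimF (zB Z) * homF (zB Z) = 1 + n * d.
Proof. by rewrite (class_weight (forget_B Z)) sum_nat_delta. Qed.

Lemma weight_A psi : lin_char psi -> psi <> [ffun=> 1] ->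
  qdimF (zA Z psi) * homF (zA Z psi) = 2 + n * d.
Proof.
move=> psiP psi1.
by rewrite (class_weight (forget_A Z psiP psi1)) -big_distrr /= sum_nat_delta muln1.
Qed.

Lemma weight_C h phi : h \in zreps Z -> lin_char phi ->
  qdimF (zC Z h phi) * homF (zC Z h phi) = 2 + n * d.
Proof.
move=> hP phiP.
by rewrite (class_weight (forget_C hP phiP)) big_split /= !sum_nat_delta.
Qed.

Lemma weight_D l : qdimF (zD Z l) * homF (zD Z l) = n * d.
Proof. by rewrite (class_weight (forget_D Z l)) big1 ?add0r. Qed.

(** Summing over the characters of G turns the twists [phi h] of the objects C into
    the condition [h^k = 1], and the pairs [h, h^-1] then give
    [(pow_count k 1 - 1) / 2]. The terms of B and of the A's supply exactly the
    missing contribution of [h = 1], up to the summand [n d / 2] kept with the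
    twists of the D's. *)
Lemma center_sum_rho k : (1 <= k)%N ->
  \sum_i theta i ^+ k * qdimF i * homF i
  = 2^-1 * n * (2 + n * d) * (pow_count k (1%g : gT))%:R
    + n * d * (2^-1 + \sum_l theta (zD Z l) ^+ k).
Proof.
move=> kpos; have [J [chi [chiP chi_sum chi_once]]] := lin_char_basis K abelG.
have cardJ : #|J|%:R = n :> K.
  have := chi_sum 1%g; rewrite eqxx mulr1 => <-.
  by under eq_bigr do rewrite (chiP _).1; rewrite sumr_const.
rewrite (sum_center Z oddG chiP chi_once) hom_z1 mulr0 add0r.
rewrite (theta_B Z) expr1n mul1r weight_B.
have -> : \sum_(a | chi a != [ffun=> 1]) theta (zA Z (chi a)) ^+ k * qdimF (zA Z (chi a))
    * homF (zA Z (chi a)) = (n - 1) * (2 + n * d).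
  rewrite (eq_bigr (fun=> 2 + n * d)) => [|a /eqP a1]; last first.
    by rewrite theta_A // expr1n mul1r weight_A.
  rewrite sumr_const -[LHS]mulr_natl; congr (_ * _).
  have triv_char : lin_char ([ffun=> 1] : {ffun gT -> K}).
    by split=> [|g h]; rewrite !ffunE ?mulr1.
  have card1 : #|[pred a | chi a == [ffun=> 1]]| = 1%N.
    rewrite -sum1_card big_mkcond -[RHS](chi_once _ triv_char).
    by apply: eq_bigr => a _; rewrite inE; case: (chi a == _).
  by rewrite -cardJ -(cardC [pred a | chi a == [ffun=> 1]]) card1 natrD addrAC subrr add0r.
have -> : \sum_(h in zreps Z) \sum_a theta (zC Z h (chi a)) ^+ k * qdimF (zC Z h (chi a))
    * homF (zC Z h (chi a)) = (2 + n * d) * n * \sum_(h in zreps Z) ((h ^+ k)%g == 1%g)%:R.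
  rewrite mulr_sumr; apply: eq_bigr => h hP.
  under eq_bigr => a _.
    rewrite theta_C // -mulrA weight_C // -lin_charX //.
    over.
  by rewrite -mulr_suml chi_sum mulrC mulrA.
have -> : \sum_(h in zreps Z) ((h ^+ k)%g == 1%g)%:R
    = 2^-1 * ((pow_count k (1%g : gT))%:R - 1) :> K.
  rewrite (sum_half_system (F := fun h => ((h ^+ k)%g == 1%g)%:R : K) (zrepsP Z)).
    rewrite expg1n eqxx /pow_count -sum1_card natr_sum [in RHS]big_mkcond.
    congr (_ * (_ - _)); apply: eq_bigr => h _; rewrite inE.
    by case: ifP.
  by move=> h; rewrite expgVn invg_eq1.
under [X in _ + X = _]eq_bigr do rewrite -mulrA weight_D.
rewrite -mulr_suml; set s := \sum_l _.
by field.
Qed.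
End CenterSumRho.

Theorem theorem5p4 (R : realType) (gT : finGroupType)
    (abelG : abelian [set: gT]) (oddG : odd #|gT|)
    (C : fusioncat R[i]) (j : spherical C)
    (S : HIbasis gT -> C) (CHI : is_HI S)
    (I : finType) (X : I -> drinfeld_center C) (Xsimple : simple_reps X)
    (theta : I -> R[i]) (o : bool)
    (thetaP : forall i, is_twist j o (X i) (theta i))
    (theta_orient : forall (k : nat) (Y : C), (1 <= k)%N ->
      FS_indicator j k Y =
        (global_dim j S)^-1 *
        \sum_i theta i ^+ k * qdim j (forget (X i))
               * (\dim {: Mor (forget (X i)) Y})%:R)
    (Z : EG_center S X theta)
    (qdim_rho_gt0 : 0 < qdim j (S (inr 1%g)))
    (hT : finGroupType) (q : hT -> QmodZ) (Hmetric : metric_group q)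
    (Hcard : #|hT| = (#|gT| ^ 2 + 4)%N)
    (idx : hT -> 'I_(HIm gT))
    (idx_surj : forall l, exists2 h, h <> 1%g & idx h = l)
    (idx_eq : forall h h', h <> 1%g -> h' <> 1%g ->
      idx h = idx h' <-> h = h' \/ h = h'^-1%g)
    (theta_D : forall h, h <> 1%g ->
      theta (zD Z (idx h)) = expQZ R (q h *+ HIm gT))
    (k : nat) (kpos : (1 <= k)%N) :
  FS_indicator j k (S (inr 1%g)) =
    2^-1 * (pow_count k (1%g : gT))%:R
    + 2^-1 * gauss_sum R (fun h => q h *+ (k * HIm gT)).
Proof.
have oddH : odd #|hT| by rewrite Hcard oddD oddX oddG.
have twist_D : \sum_l theta (zD Z l) ^+ k
    = 2^-1 * (\sum_h expQZ R (q h *+ (k * HIm gT)) - 1).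
  rewrite (sum_two_to_one oddH (fun l => theta (zD Z l) ^+ k) idx_surj idx_eq).
  congr (_ * _); rewrite [in RHS](bigD1 1%g) //= quadratic_form1; last by case: Hmetric.
  rewrite mul0rn expQZ0 [RHS]addrC addKr; apply: eq_bigr => h /eqP h1.
  by rewrite theta_D // mulnC mulrnA !expQZMn.
rewrite theta_orient // (global_dim_HI oddG CHI) //.
rewrite (center_sum_rho abelG oddG CHI qdim_rho_gt0 Z kpos) twist_D.
rewrite /gauss_sum (sqrt_discriminant oddG CHI qdim_rho_gt0 Hcard).
have d2 := qdim_rho_sqr oddG CHI qdim_rho_gt0.
set d := qdim j _ in d2 qdim_rho_gt0 *; set n := #|gT|%:R in d2 *.
set P := (pow_count _ _)%:R; set G := \sum_h _.
have n_gt0 : 0 < n by rewrite ltr0n (cardD1 1%g).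
have nd_gt0 : 0 < 2 + n * d by rewrite addr_gt0 ?mulr_gt0.
(* this is d * sqrt (n^2 + 4) *)
have sE : d * (2 * d - n) = 2 + n * d.
  have -> : d * (2 * d - n) = 2 * d ^+ 2 - n * d by ring.
  by rewrite d2; ring.
have s_neq0 : 2 * d - n != 0.
  by apply: contraTneq nd_gt0 => s0; rewrite -sE s0 mulr0 ltxx.
by rewrite -sE; field; rewrite s_neq0 (gt_eqF qdim_rho_gt0) (gt_eqF n_gt0).
Qed.
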